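(* Let $G$ be a locally finite graph and $r\ge 3$ an integer. The following are equivalent: (i) $G$ is $r$-locally chordal. (ii) $G$ admits a graph-decomposition into its maximal cliques which induces $r$-local separations. (iii) $G$ admits a canonical graph-decomposition into cliques which induces $r$-local separations. (iv) $G$ admits a graph-decomposition into cliques which induces $r$-local separations.
   Context: All graphs are simple and possibly infinite; locally finite means every vertex has finite degree. The ball $B_{r/2}(v)$ is the subgraph of $G$ whose vertices are those at distance at most $r/2$ from $v$ and whose edges are the edges of $G$ for which the sum of the distances of the endpoints to $v$ is strictly less than $r$. A graph is chordal if each of its cycles of length at least $4$ has a chord; $G$ is $r$-locally chordal if every ball $B_{r/2}(v)$, $v\in V(G)$, is chordal. A graph-decomposition of $G$ is a pair $(H,\mathcal V)$ of a graph $H$ and a family $\mathcal V=(V_h)_{h\in V(H)}$ of vertex-subsets of $G$ (bags) such that $G=\bigcup_hG[V_h]$ and, for every vertex $v$, the co-part $H_v:=H[W_v]$ is connected, where $W_v=\{h\in V(H):v\in V_h\}$. It is into cliques if every $V_h$ is a clique of $G$ (empty set allowed), and into the maximal cliques of $G$ if $h\mapsto V_h$ is a bijection from $V(H)$ to the set of inclusion-maximal cliques of $G$. It is canonical if there is an action of $\mathrm{Aut}(G)$ on $H$ (by graph automorphisms) with $\gamma(V_h)=V_{\gamma\cdot h}$ for all $\gamma\in\mathrm{Aut}(G)$ and $h\in V(H)$. For $X\subseteq V(G)$ let $\partial_GX$ be the set of edges of $G$ with exactly one end in $X$. A pre-separation of $G$ is a set $\{E_0,X,E_1\}$ with $X\subseteq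 V(G)$ and $E_0,E_1$ disjoint with union $\partial_GX$. An $X$-walk is a walk that starts and ends in $X$ but internally avoids $X$; it is $r$-local if it is contained in a cycle of $G$ of length at most $r$ or consists of a single edge with both ends in $X$. A pre-separation $\{E_0,X,E_1\}$ is an $r$-local separation if no $r$-local $X$-walk traverses both an edge of $E_0$ and an edge of $E_1$. Suppose $(H,\mathcal V)$ satisfies (a) $H_v$ is a tree for every vertex $v$ of $G$, and (b) $H_u\cap H_v$ is connected for every edge $uv$ of $G$. For an edge $f=h_0h_1$ of $H$ let $V_f=V_{h_0}\cap V_{h_1}$; for $v\in V_f$ and $i=0,1$ let $H_i^v$ be the component of $H_v-f$ containing $h_i$, let $E_i^v=\{vw\in\partial_GV_f: w\in V_h\text{ for some }h\in V(H_i^v)\}$ and $E_i=\bigcup_{v\in V_f}E_i^v$. Then $\{E_0,V_f,E_1\}$ is a pre-separation of $G$, the one induced by $f$. $(H,\mathcal V)$ induces $r$-local separations if it satisfies (a) and (b) and, for every edge $f$ of $H$, the pre-separation induced by $f$ is an $r$-local separation of $G$. *)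

(* Defs.v *)
From mathcomp Require Import all_boot all_classical.

Set Implicit Arguments.
Unset Strict Implicit.
Unset Printing Implicit Defensive.

Local Open Scope classical_set_scope.

(* Simple graphs, possibly infinite.  Choice on the vertices and a boolean
   adjacency relation are no restriction under the classical axioms. *)
Record graph := Graph {
  vertex :> choiceType;
  adj : rel vertex;
  adj_sym : symmetric adj;
  adj_irr : irreflexive adj
}.
Arguments adj {g} _ _.

Record subgraph (G : graph) := Subgraph {
  vset : set G;
  edge : rel G;
  edge_adj : forall x y, edge x y -> adj x y;
  edge_sym : symmetric edge;
  edge_vset : forall x y, edge x y -> vset x
}.

Definition locally_finite (G : graph) : Prop :=
  forall v : G, finite_set [set w : G | adj v w].

(* A walk is given by its first vertex [x] and the sequence [p] of its
   remaining vertices; its length is [size p]. *)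
Definition walk_edges (T : choiceType) (x : T) (p : seq T) : set (set T) :=
  [set [set z.1; z.2] | z in [set` zip (x :: p) p]].

(* A cycle is given by the sequence of its vertices in cyclic order; its length
   is [size c]. *)
Definition is_cycle (T : choiceType) (e : rel T) (c : seq T) : Prop :=
  [/\ (3 <= size c)%N, cycle e c & uniq c].

Definition cycle_edges (T : choiceType) (c : seq T) : set (set T) :=
  [set [set x; next c x] | x in [set` c]].

Section Subgraphs.
Variable G : graph.
Implicit Types (A B : subgraph G) (X : set G).

Definition component A (x : G) : set G :=
  [set y | vset A x /\ exists2 p, path (edge A) x p & last x p = y].

Definition connected_subgraph A : Prop :=
  vset A !=set0 /\ forall x y, vset A x -> vset A y -> component A x y.

Definition is_tree A : Prop :=
  connected_subgraph A /\ forall c, ~ is_cycle (edge A) c.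

Definition chordal A : Prop :=
  forall c, is_cycle (edge A) c -> (4 <= size c)%N ->
  exists x y, [/\ x \in c, y \in c, edge A x y, y != next c x & x != next c y].

Program Definition induced X : subgraph G :=
  @Subgraph G X (fun x y => [&& adj x y, x \in X & y \in X]) _ _ _.
Next Obligation. by move=> X x y /and3P[]. Qed.
Next Obligation. by move=> X x y /=; rewrite adj_sym [(x \in X) && _]andbC. Qed.
Next Obligation. by move=> X x y /and3P[_ /set_mem]. Qed.

Program Definition inter_subgraph A B : subgraph G :=
  @Subgraph G (vset A `&` vset B) (fun x y => edge A x y && edge B x y) _ _ _.
Next Obligation. by move=> A B x y /andP[/edge_adj]. Qed.
Next Obligation. by move=> A B x y /=; rewrite (edge_sym A) (edge_sym B). Qed.
Next Obligation. by move=> A B x y /andP[/edge_vset ? /edge_vset ?]. Qed.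

Program Definition del_edge A (a b : G) : subgraph G :=
  @Subgraph G (vset A)
    (fun x y => [&& edge A x y, (x, y) != (a, b) & (x, y) != (b, a)]) _ _ _.
Next Obligation. by move=> A a b x y /and3P[/edge_adj]. Qed.
Next Obligation.
move=> A a b x y /=; rewrite (edge_sym A) !xpair_eqE.
by congr andb; rewrite andbC; congr (~~ _ && ~~ _); rewrite andbC.
Qed.
Next Obligation. by move=> A a b x y /and3P[/edge_vset]. Qed.

(* The distance between [x] and [y] is [n]; there is no such [n] when [x] and
   [y] lie in different components. *)
Definition is_dist (x y : G) (n : nat) : Prop :=
  (exists p, [/\ path adj x p, last x p = y & size p = n]) /\
  (forall p, path adj x p -> last x p = y -> (n <= size p)%N).

Definition ball_vset (r : nat) (v : G) : set G :=
  [set x | exists2 n, is_dist v x n & (n.*2 <= r)%N].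

Definition ball_edge (r : nat) (v x y : G) : Prop :=
  exists m n, [/\ is_dist v x m, is_dist v y n & (m + n < r)%N].

(* The ball of radius r/2.  By the triangle inequality, [adj x y] and
   [ball_edge r v x y] already put [x] and [y] in [ball_vset r v]. *)
Program Definition ball (r : nat) (v : G) : subgraph G :=
  @Subgraph G (ball_vset r v)
    (fun x y => [&& adj x y, x \in ball_vset r v, y \in ball_vset r v
                  & `[< ball_edge r v x y >]]) _ _ _.
Next Obligation. by move=> r v x y /and4P[]. Qed.
Next Obligation.
move=> r v x y /=; rewrite adj_sym; congr andb; rewrite andbCA.
congr [&& _, _ & _]; apply/asboolP/asboolP => -[m [n [? ? ?]]];
  by exists n, m; split=> //; rewrite addnC.
Qed.
Next Obligation. by move=> r v x y /and4P[_ /set_mem]. Qed.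

Definition locally_chordal (r : nat) : Prop := forall v : G, chordal (ball r v).

Definition clique X : Prop := forall x y, X x -> X y -> x != y -> adj x y.

Definition maximal_clique X : Prop :=
  clique X /\ forall Y, clique Y -> X `<=` Y -> Y = X.

(* Edges are two-element vertex sets. *)
Definition boundary X : set (set G) :=
  [set e | exists x y, [/\ adj x y, X x, ~ X y & e = [set x; y]]].

Definition pre_separation (E0 : set (set G)) X (E1 : set (set G)) : Prop :=
  E0 `&` E1 = set0 /\ E0 `|` E1 = boundary X.

(* [behead (belast x p)] lists the internal vertices of the walk. *)
Definition set_walk X (x : G) (p : seq G) : Prop :=
  [/\ path adj x p, X x, X (last x p)
    & forall z, z \in behead (belast x p) -> ~ X z].

Definition local_set_walk (r : nat) X (x : G) (p : seq G) : Prop :=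
  set_walk X x p /\
  ((exists c, [/\ is_cycle adj c, (size c <= r)%N, {subset x :: p <= c}
                & walk_edges x p `<=` cycle_edges c])
   \/ (exists y, p = [:: y] /\ X y)).

Definition local_separation (r : nat) (E0 : set (set G)) X (E1 : set (set G))
    : Prop :=
  pre_separation E0 X E1 /\
  forall x p, local_set_walk r X x p ->
    ~ (walk_edges x p `&` E0 !=set0 /\ walk_edges x p `&` E1 !=set0).

End Subgraphs.

Record automorphism (G : graph) := Automorphism {
  aut_fun :> G -> G;
  aut_bij : bijective aut_fun;
  aut_adj : forall x y, adj (aut_fun x) (aut_fun y) = adj x y
}.

Program Definition aut_id (G : graph) : automorphism G :=
  @Automorphism G id _ _.
Next Obligation. by move=> G; exists id. Qed.
Next Obligation. by []. Qed.

Program Definition aut_comp (G : graph) (f g : automorphism G)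
  : automorphism G := @Automorphism G (f \o g) _ _.
Next Obligation. by move=> G f g; apply: bij_comp; apply: aut_bij. Qed.
Next Obligation. by move=> G f g x y /=; rewrite !aut_adj. Qed.

Section Decompositions.
Variables G H : graph.
Implicit Type V : H -> set G.

Definition copart V (v : G) : subgraph H := induced [set h | V h v].

(* The first two clauses say that G is the union of the subgraphs G[V h]. *)
Definition graph_decomposition V : Prop :=
  [/\ forall v, exists h, V h v,
      forall u v, adj u v -> exists h, V h u /\ V h v
    & forall v, connected_subgraph (copart V v)].

Definition into_cliques V : Prop := forall h, clique (V h).

Definition into_maximal_cliques V : Prop :=
  set_bij [set: H] [set K | maximal_clique K] V.

Definition canonical_decomposition V : Prop :=
  exists act : automorphism G -> automorphism H,
  [/\ forall h, act (aut_id G) h = h,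
      forall (f g : automorphism G) h, act (aut_comp f g) h = act f (act g h)
    & forall (f : automorphism G) h, f @` V h = V (act f h)].

Definition adhesion V (h0 h1 : H) : set G := V h0 `&` V h1.

(* For the edge f = h0h1: the edges E_0^v, where the component of H_v - f is the
   one containing h0.  Exchanging h0 and h1 yields E_1^v. *)
Definition side_edges_at V (h0 h1 : H) (v : G) : set (set G) :=
  [set e | boundary (adhesion V h0 h1) e /\
     exists w h, [/\ e = [set v; w], V h w
                   & component (del_edge (copart V v) h0 h1) h0 h]].

Definition side_edges V (h0 h1 : H) : set (set G) :=
  \bigcup_(v in adhesion V h0 h1) side_edges_at V h0 h1 v.

Definition induces_local_separations (r : nat) V : Prop :=
  [/\ forall v, is_tree (copart V v),
      forall u v, adj u v ->
        connected_subgraph (inter_subgraph (copart V u) (copart V v))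
    & forall h0 h1, adj h0 h1 ->
        local_separation r (side_edges V h0 h1) (adhesion V h0 h1)
                           (side_edges V h1 h0)].

End Decompositions.

(* Main.v *)
Require Import Defs.
From mathcomp Require Import all_boot all_classical zify.

(** It suffices to derive (i) from (iv), and (ii) and (iii) from (i): both (ii) and
(iii) contain (iv), since maximal cliques are cliques.

From a decomposition to chordal balls.  Let {E0, S, E1} be an r-local
separation.  Cutting a cycle of length at most r at its vertices in S leaves
S-walks, each of which has its two boundary edges on the same side; so every
such cycle, and hence every closed walk of length at most r, uses E0 an even
number of times ([short_closed_walk_even]).  In a ball of radius r/2 around v,
an edge together with geodesics from v to its two ends is a closed walk of
length at most r, so membership in E0 is the difference of a potential, and
every cycle of the ball uses E0 an even number of times ([ball_cycle_even]).
Let b be a vertex of a cycle of the ball with non-adjacent cycle neighbours a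
and c.  Some edge of the tree H_b separates the bags containing a from those
containing c, which gives a clique S through b with ba in E0 and bc in E1
([separate_neighbours]).  By parity the cycle meets S in another vertex, which
is adjacent to b and yields a chord.  Edges of G between two vertices at
distance exactly r/2 are not edges of the ball; if b has distance r/2, parity
along the geodesics to a and c already contradicts non-adjacency
([sphere_separation]).

From chordal balls to decompositions.  If every ball is chordal, then cycles of
length at most r have chords, and so do cycles inside a closed neighbourhood.
Both decompositions are instances of one construction.  Its nodes form a family
of cliques.  For every nonempty clique S, the vertices complete to S form the
link of S; one node root S containing S is joined, for each component C of the
link not met by root S, to one node rep S C that contains S and meets C.
Induction on S, downwards from large cliques, shows that the nodes containing S
induce a connected graph ([clique_graph_connected]).  A cycle in the graph of
the nodes containing v cannot exist ([clique_graph_acyclic]): at an edge of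
the cycle with smallest adhesion set S, the rest of the cycle would connect
the component C to root S in the neighbourhood of v while avoiding S, and in a
chordal neighbourhood two vertices of the link that are connected outside S are
connected inside the link ([link_component]).

Taking all maximal cliques as nodes and arbitrary choices of root and rep gives
(ii).  Taking all cliques as nodes, root S = S and rep S C = S together with a
clique of C that is invariant under automorphisms gives (iii).  Such an
invariant clique is what remains after repeatedly deleting all simplicial
vertices of C; the process cannot get stuck because of Dirac's theorem
([simplicial_nonadjacent], [centreP]).

The separations so obtained are r-local ([induced_local_separation]): the two
edges of a triangle that leave S lie on the same side because the triangle lies
in a bag, and a cycle of length at most r can be filled with triangles. *)

Set Implicit Arguments.
Unset Strict Implicit.
Unset Printing Implicit Defensive.

Local Open Scope classical_set_scope.

(** * Components, and paths inside a neighbourhood *)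

Section Components.
Variable G : graph.
Implicit Types (A B : subgraph G) (X Y : set G) (x y z : G).

Lemma induced_edgeP X x y :
  reflect [/\ adj x y, X x & X y] (edge (induced X) x y).
Proof.
by apply: (iffP and3P) => -[xy /[1!inE] ? /[1!inE] ?]; split; rewrite ?inE.
Qed.

Lemma component_refl A x : vset A x -> component A x x.
Proof. by move=> Ax; split=> //; exists [::]. Qed.

Lemma component_edge A x y : edge A x y -> component A x y.
Proof. by move=> xy; split; [exact: edge_vset xy | exists [:: y] => //=; rewrite xy]. Qed.

Lemma component_trans A y x z :
  component A x y -> component A y z -> component A x z.
Proof.
move=> [Ax [p xp <-]] [_ [q yq <-]]; split=> //.
by exists (p ++ q); rewrite ?cat_path ?xp // last_cat.
Qed.

Lemma component_sym A x y : component A x y -> component A y x.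
Proof.
move=> [Ax [p xp <-]] {y}; elim: p x Ax xp => [|z p IH] x Ax /=.
  by move=> _; apply: component_refl.
case/andP=> xz /IH zp; apply: (component_trans (zp _)).
  by rewrite edge_sym in xz; exact: edge_vset xz.
by apply: component_edge; rewrite edge_sym.
Qed.

Lemma component_ind A x (Q : G -> Prop) :
  Q x -> (forall y z, component A x y -> Q y -> edge A y z -> Q z) ->
  forall y, component A x y -> Q y.
Proof.
move=> Qx IH y [Ax [p xp <-]] {y}; elim/last_ind: p xp => [//|p y IHp].
rewrite rcons_path last_rcons => /andP[xp py].
by apply: (IH (last x p)) => //; [split=> //; exists p | exact: IHp].
Qed.

Lemma component_vset A x y : component A x y -> vset A y.
Proof.
move=> xy; apply: (component_ind _ _ xy); first by case: xy.
by move=> {xy} y' z _ _ yz; rewrite edge_sym in yz; exact: edge_vset yz.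
Qed.

Lemma component_sub A B x y : vset A `<=` vset B -> subrel (edge A) (edge B) ->
  component A x y -> component B x y.
Proof.
move=> AB eAB [Ax [p xp <-]]; split; first exact: AB.
by exists p => //; exact: sub_path xp.
Qed.

Lemma induced_mono X Y : X `<=` Y -> subrel (edge (induced X)) (edge (induced Y)).
Proof.
by move=> XY x y /induced_edgeP[? ? ?]; apply/induced_edgeP; split=> //; exact: XY.
Qed.

Lemma component_induced_sub X Y x y : X `<=` Y ->
  component (induced X) x y -> component (induced Y) x y.
Proof. by move=> XY; apply: component_sub => //; exact: induced_mono. Qed.

Lemma component_connected A x y : component A x y ->
  component (induced (component A x)) x y.
Proof.
move=> xy; have Ax : vset A x by case: xy.
move: y xy; apply: component_ind.
  by apply: component_refl; exact: component_refl.
move=> y z xy IH yz; apply: (component_trans IH); apply: component_edge.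
apply/induced_edgeP; split=> //; first exact: edge_adj yz.
by apply: (component_trans xy); exact: component_edge.
Qed.

Lemma component_induced_eq X x y : component (induced X) x y ->
  component (induced X) x = component (induced X) y.
Proof.
move=> xy; apply/seteqP; split=> z; last exact: component_trans.
by apply: component_trans; apply: component_sym.
Qed.

Lemma path_induced_sub X x p :
  X x -> path (edge (induced X)) x p -> forall z, z \in x :: p -> X z.
Proof.
elim: p x => [|y p IH] x Xx.
  by move=> _ z; rewrite inE => /eqP->.
rewrite [path _ _ _]/= => /andP[/induced_edgeP[_ _ Xy] /IH yp] z.
by rewrite inE => /predU1P[->//|]; apply: yp.
Qed.

Lemma path_induced X x p : path adj x p -> (forall z, z \in x :: p -> X z) ->
  path (edge (induced X)) x p.
Proof.
elim: p x => // y p IH x; rewrite [path _ _ _]/= => /andP[xy yp] sX.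
rewrite /path -/(path _ _ _); apply/andP; split.
  by apply/induced_edgeP; split=> //; apply: sX; rewrite !inE eqxx ?orbT.
by apply: IH => // z zp; apply: sX; rewrite inE zp orbT.
Qed.

Lemma chordal_mono X Y : X `<=` Y -> chordal (induced Y) -> chordal (induced X).
Proof.
move=> XY chY c [c3 cc uc] c4.
have cX x : x \in c -> X x.
  by move=> xc; have /induced_edgeP[] := next_cycle cc xc.
have [|x [y [xc yc /induced_edgeP[xy _ _] nx ny]]] := chY c _ c4.
  split=> //; case: c cc {c3 uc c4 cX} => //= x p; exact/sub_path/induced_mono.
exists x, y; split=> //; apply/induced_edgeP; split=> //; exact: cX.
Qed.

(** A chord of a cycle through the path provides u and w that are not consecutive;
    this makes the shortcut strictly shorter. *)
Lemma path_shortcut (e : rel G) x p u w : path e x p ->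
  (index u (x :: p)).+1 < index w (x :: p) -> w \in x :: p -> e u w ->
  exists p', [/\ path e x p', last x p' = last x p & size p' < size p].
Proof.
elim: p x => [|y p IH] x.
  by rewrite inE => _ /= + /eqP xw; rewrite xw eqxx; case: (u =P w).
case/andP=> xy yp; rewrite -/(path e y p) in yp.
have [->|xu] := eqVneq u x.
  rewrite /= eqxx; have [//|xw] := eqVneq x w.
  have [//|yw] := eqVneq y w; move=> _.
  rewrite !inE eq_sym (negbTE xw) eq_sym (negbTE yw) /= => wp.
  case/splitPr: wp yp => p1 p2; rewrite cat_path /= => /and3P[_ _ wp2] uw.
  exists (w :: p2) => /=; rewrite uw last_cat; split=> //.
  by rewrite size_cat /= addnS ltnS ltnS leq_addl.
rewrite [index u _]/= eq_sym (negbTE xu).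
have [->|xw] := eqVneq w x; first by rewrite /= eqxx.
rewrite [index w _]/= (eq_sym x w) (negbTE xw) ltnS => uw.
rewrite in_cons (negbTE xw) /= => wp euw.
have [p' [yp' lp' sp']] := IH y yp uw wp euw.
by exists (y :: p'); split=> //=; rewrite xy.
Qed.

(** Going back and forth between a path and s gives a cycle unless the path is an
    edge.  A chord of that cycle either shortens the path or ends in s and splits
    the path at a neighbour of s; induction on the length of the path does the
    rest. *)
Lemma component_in_nbhd X s x y : ~ X s -> chordal (induced (X `|` [set s])) ->
  adj s x -> adj s y -> component (induced X) x y ->
  component (induced (X `&` [set z | adj s z])) x y.
Proof.
move=> Xs chX sx sy [/= Xx [p xp pl]].
(* The induction ranges over all pairs of neighbours of s, since a chord at s
   splits the path. *)
have [n] := ubnP (size p); elim: n p x y sx sy Xx xp pl => // n IH p x y.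
move=> sx sy Xx xp pl; rewrite ltnS => pn.
move: pl; case/shortenP: xp => {}p' xp up' pp pl.
have {pp}pn : size p' <= n by apply: leq_trans pn; exact: uniq_leq_size (andP up').2 pp.
have pX := path_induced_sub Xx xp.
have Xy : X y by rewrite -pl; apply/pX/mem_last.
case: {p} p' xp up' pn pl pX => [|q p]; first by move=> _ _ _ <- _; exact: component_refl.
case: p => [|q' p].
  move=> + _ _ qy _; rewrite /= andbT in qy * => /induced_edgeP[xq _ _].
  by apply: component_edge; apply/induced_edgeP; rewrite -?qy in Xy sy *; split.
move: (q :: q' :: p) (isT : 1 < size (q :: q' :: p)) => {p q q'} P P2 xp uP pn pl pX.
have sP : s \notin x :: P by apply/negP => /pX.
have padj : path adj x P by apply: sub_path xp => ? ? /induced_edgeP[].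
have [||u [w [uc wc /induced_edgeP[uw _ _] wu' uw']]] := chX (s :: x :: P) _ _.
- split; [by rewrite /= !ltnS ltnW | | by rewrite cons_uniq sP].
  rewrite [cycle _ _]/cycle; apply: path_induced.
    have scyc : path adj s (rcons (x :: P) s).
      by rewrite rcons_cons [path _ _ _]/= sx rcons_path padj pl adj_sym.
    exact: scyc.
  move=> z; rewrite inE mem_rcons inE => zc.
  case/or3P: zc => [/eqP->|/eqP->|/pX]; by [right|left].
- by rewrite /= !ltnS.
(* A chord at s ends in an inner vertex m of the path. *)
have split_hub m : m \in x :: P -> m != x -> m != y -> adj s m ->
    component (induced (X `&` [set z | adj s z])) x y.
  rewrite inE => /predU1P[->|]; first by rewrite eqxx.
  move=> mP mx my sm; have Xm : X m by apply/pX; rewrite inE mP orbT.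
  case/splitPr: mP xp pn pl => p1 [|z p2].
    by rewrite last_cat /= => _ _ my'; rewrite my' eqxx in my.
  rewrite cat_path /= last_cat size_cat /= => /and3P[xp1 p1m mp2] pn pl.
  apply: (@component_trans _ m).
    apply: (IH (rcons p1 m)) => //; rewrite ?last_rcons ?rcons_path ?xp1 //.
    by rewrite size_rcons; apply: leq_trans pn; rewrite addnS ltnS addnS ltnS leq_addr.
  apply: (IH (z :: p2)) => //; apply: leq_trans pn.
  by rewrite /= !addnS !ltnS leq_addl.
have inP z : z \in s :: x :: P -> z != s -> z \in x :: P.
  by rewrite inE => /predU1P[->|]; rewrite ?eqxx.
have nextE z : z \in x :: P -> next (s :: x :: P) z =
    nth s (x :: P) (index z (x :: P)).+1.
  move=> zP; have zs : s != z by apply: contraNneq sP => ->.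
  by rewrite next_nth in_cons zP orbT /= (negbTE zs).
have next_y : next (s :: x :: P) y = s.
  by rewrite -pl nextE ?mem_last // index_last // nth_default.
have next_s : next (s :: x :: P) s = x by rewrite next_nth mem_head /= eqxx.
have [us|us] := eqVneq u s.
  have ws : w != s by apply: contraTneq uw => ->; rewrite us adj_irr.
  rewrite us next_s in uw wu' uw'.
  apply: (split_hub w) => //; first exact: inP.
  by apply: contraNneq uw' => ->; rewrite next_y.
have [ws|ws] := eqVneq w s.
  rewrite ws next_s in uw wu' uw'.
  apply: (split_hub u) => //; [exact: inP | | by rewrite adj_sym].
  by apply: contraNneq wu' => ->; rewrite next_y.
(* A chord between two vertices of the path shortens the path. *)
have split_path u' w' : u' \in x :: P -> w' \in x :: P -> adj u' w' ->
    w' != next (s :: x :: P) u' -> index u' (x :: P) < index w' (x :: P) ->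
    component (induced (X `&` [set z | adj s z])) x y.
  move=> u'P w'P uw1 /[!nextE]// nuw lt_uw.
  have [||p' [xp' lp' sp']] := path_shortcut xp _ w'P (_ : edge (induced X) u' w').
  - rewrite ltn_neqAle lt_uw andbT; apply: contraNneq nuw => ->.
    by rewrite nth_index.
  - by apply/induced_edgeP; split=> //; exact: pX.
  by apply: (IH p') => //; [rewrite lp' | apply: leq_trans pn].
have [lt_uw|lt_wu|] := ltngtP (index u (x :: P)) (index w (x :: P)).
- by apply: (split_path u w) => //; apply: inP.
- by apply: (split_path w u) => //; rewrite 1?adj_sym ?inP.
move/(congr1 (nth s (x :: P))); rewrite !nth_index ?inP // => uw_eq.
by rewrite uw_eq adj_irr in uw.
Qed.

End Components.

(** * Cliques and their links *)

Section Cliques.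
Variable G : graph.
Implicit Types (X Y S K C : set G) (l : seq G) (v x y z : G).

Definition closed_nbhd v : set G := [set z | z = v \/ adj v z].

Definition link S : set G := [set x | ~ S x /\ forall s, S s -> adj s x].

Lemma clique_sub_nbhd K v : clique K -> K v -> K `<=` closed_nbhd v.
Proof.
move=> cK Kv z Kz; have [->|zv] := eqVneq z v; first by left.
by right; apply: cK; rewrite // eq_sym.
Qed.

Lemma clique_subset X Y : X `<=` Y -> clique Y -> clique X.
Proof. by move=> XY cY x y /XY ? /XY; exact: cY. Qed.

Lemma clique_setU1 S x : clique S -> (forall s, S s -> s != x -> adj s x) ->
  clique (S `|` [set x]).
Proof.
move=> cS Sx a b [Sa|->] [Sb|->] ab; first exact: cS.
- exact: Sx.
- by rewrite adj_sym; apply: Sx; rewrite // eq_sym.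
- by rewrite eqxx in ab.
Qed.

Lemma clique1 v : clique [set v].
Proof. by move=> x y -> ->; rewrite eqxx. Qed.

Lemma clique2 (u : G) v : adj u v -> clique [set u; v].
Proof.
move=> uv; apply: clique_setU1; first exact: clique1.
by move=> s ->.
Qed.

Lemma clique_link S x : clique S -> link S x -> clique (S `|` [set x]).
Proof. by move=> cS [_ Sx]; apply: clique_setU1 => // s /Sx. Qed.

Lemma clique_link2 S x y : clique S -> link S x -> link S y -> adj x y ->
  clique (S `|` [set x] `|` [set y]).
Proof.
move=> cS lx [_ Sy] xy; apply: clique_setU1; first exact: clique_link.
by move=> s [/Sy|->].
Qed.

Lemma clique_diff_link S K : clique K -> S `<=` K -> K `\` S `<=` link S.
Proof.
move=> cK SK x [Kx nSx]; split=> // s Ss; apply: cK => //; first exact: SK.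
by apply: contra_not_neq nSx => <-.
Qed.

Lemma link_sub_nbhd S v : S v -> link S `<=` closed_nbhd v `\` S.
Proof. by move=> Sv x [nSx /(_ v Sv)]; split=> //; right. Qed.

Lemma clique_component X K x y : clique K -> K `<=` X -> K x -> K y ->
  component (induced X) x y.
Proof.
move=> cK KX Kx Ky; have [->|xy] := eqVneq x y.
  by apply: component_refl; apply: KX.
by apply/component_edge/induced_edgeP; split; [exact: cK | exact: KX..].
Qed.

Lemma count_mem_lt l X Y z : X `<=` Y -> Y z -> ~ X z -> z \in l ->
  count (fun u => u \in X) l < count (fun u => u \in Y) l.
Proof.
move=> XY Yz nXz; elim: l => //= a l IH; rewrite inE => /predU1P[<-|/IH lt_l].
  rewrite (memNset nXz) (mem_set Yz) add0n add1n ltnS.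
  by apply: sub_count => u /set_mem/XY/mem_set.
rewrite -addnS leq_add //; case: (boolP (a \in X)) => //= /set_mem/XY/mem_set.
by move=> /= ->.
Qed.

(** One vertex of S after the other, [component_in_nbhd] confines the connection to
    the neighbourhood of that vertex. *)
Lemma link_component v S x y : chordal (induced (closed_nbhd v)) ->
  finite_set S -> clique S -> S v -> link S x -> link S y ->
  component (induced (closed_nbhd v `\` S)) x y ->
  component (induced (link S)) x y.
Proof.
move=> chv /finite_seqP[l Sl] cS Sv lx ly xy.
pose A (k : seq G) := [set z | (closed_nbhd v `\` S) z /\ {in k, forall s, adj s z}].
have Sx s : s \in l -> adj s x by case: lx => _ lx sl; apply: lx; rewrite Sl.
have Sy s : s \in l -> adj s y by case: ly => _ ly sl; apply: ly; rewrite Sl.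
have: component (induced (A l)) x y.
  have: {subset l <= l} by [].
  elim: {-2}l => [_|s k IH kl].
    by apply: component_induced_sub xy => z ?; split.
  have sl : s \in l by apply: kl; rewrite mem_head.
  have Ss : S s by rewrite Sl.
  have {}IH : component (induced (A k)) x y.
    by apply: IH => t tk; apply: kl; rewrite inE tk orbT.
  apply: component_induced_sub (component_in_nbhd _ _ (Sx s sl) (Sy s sl) IH).
  - by move=> z [[Az kz] sz]; split=> // t; rewrite inE => /predU1P[->//|/kz].
  - by case=> -[_ /(_ Ss)].
  - apply: chordal_mono chv => z [[[]]//|->].
    exact: clique_sub_nbhd Ss.
apply: component_induced_sub => z [[_ nSz] lz]; split=> // s.
by rewrite Sl; exact: lz.
Qed.

(** A clique through v lies in the finite closed neighbourhood of v, so it can only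
    be enlarged finitely often. *)
Lemma maximal_clique_exists K v : locally_finite G -> clique K -> K v ->
  exists M, maximal_clique M /\ K `<=` M.
Proof.
move=> /(_ v)/finite_seqP[l Gl] cK Kv.
have inl M z : clique M -> M v -> M z -> z \in v :: l.
  move=> cM Mv /(clique_sub_nbhd cM Mv)[->|vz]; first exact: mem_head.
  rewrite inE; apply/orP; right.
  have: [set` l] z by rewrite -Gl.
  by [].
have [n] := ubnP (count (fun u => u \in ~` K) (v :: l)).
elim: n K cK Kv => // n IH K cK Kv; rewrite ltnS => leKn.
have [mK|nmK] := pselect (maximal_clique K); first by exists K; split.
have [Y [cY KY YK]] : exists Y, [/\ clique Y, K `<=` Y & Y <> K].
  apply: contrapT => noY; apply: nmK; split=> // Y cY KY.
  by apply: contrapT => YK; apply: noY; exists Y.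
have [z Yz nKz] : exists2 z, Y z & ~ K z.
  apply: contrapT => noz; apply: YK; apply/seteqP; split=> // z Yz.
  by apply: contrapT => nKz; apply: noz; exists z.
have [||M [mM YM]] := IH Y cY; first exact: KY.
  apply: leq_trans leKn; apply: (@count_mem_lt _ _ _ z).
  - exact: subsetC.
  - exact: nKz.
  - by move=> /(_ Yz).
  - by apply: (inl Y) => //; exact: KY.
by exists M; split=> // ? /KY/YM.
Qed.

End Cliques.

(** * Short cycles and neighbourhoods lie in balls *)

Lemma last_rev_belast T (x : T) (p : seq T) : last (last x p) (rev (belast x p)) = x.
Proof. by case: p => //= y p; rewrite rev_cons last_rcons. Qed.

Section Balls.
Variable G : graph.
Implicit Types (X Y S K C : set G) (v x y z : G) (r : nat).

Lemma rev_walk x p : path adj x p ->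
  path (@adj G) (last x p) (rev (belast x p)).
Proof. by move=> xp; rewrite rev_path (eq_path (fun a b => adj_sym b a)). Qed.

Lemma walk_dist v p : path adj v p ->
  exists2 n, is_dist v (last v p) n & n <= size p.
Proof.
move=> vp.
have exP : exists n, `[< exists q, [/\ path adj v q, last v q = last v p & size q = n] >].
  by exists (size p); apply/asboolP; exists p.
case: (ex_minnP exP) => n /asboolP qn minn; exists n.
  split=> // q vq qp; apply: minn; apply/asboolP; by exists q.
by apply: minn; apply/asboolP; exists p.
Qed.

Lemma rev_walk_dist v x p : path adj x p -> last x p = v ->
  exists2 n, is_dist v x n & n <= size p.
Proof.
move=> /rev_walk xp pv; have [n] := walk_dist xp.
by rewrite last_rev_belast size_rev size_belast pv; exists n.
Qed.

Lemma dist_adj v x y m n : is_dist v x m -> is_dist v y n -> adj x y -> m <= n.+1.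
Proof.
move=> [_ mx] [[p [vp <- <-]] _]; rewrite adj_sym => yx.
by rewrite -(size_rcons p x); apply: mx; rewrite ?rcons_path ?vp // last_rcons.
Qed.

Lemma ball_edge_dist r v x y m n : is_dist v x m -> is_dist v y n -> m + n < r ->
  adj x y -> edge (ball r v) x y.
Proof.
move=> dx dy mnr xy; have yx : adj y x by rewrite adj_sym.
have mn := dist_adj dx dy xy; have nm := dist_adj dy dx yx.
apply/and4P; split=> //; last by apply/asboolP; exists m, n.
- apply/mem_set; exists m => //; rewrite -addnn; apply: leq_trans mnr.
  by rewrite -addnS leq_add2l.
- apply/mem_set; exists n => //; rewrite -addnn; apply: leq_trans mnr.
  by rewrite -addSn leq_add2r.
Qed.

(** For an edge of the cycle, the two arcs that join its ends to v avoid the edge,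
    so the distances of the ends to v add up to less than the length of the
    cycle. *)
Lemma cycle_in_ball r v p : is_cycle adj (v :: p) -> size (v :: p) <= r ->
  is_cycle (edge (ball r v)) (v :: p).
Proof.
move=> [p2 cp up] pr; split=> //; move: cp pr; rewrite /= -(size_rcons p v).
move: (rcons p v) (last_rcons v p v) => q qv vq qr.
apply/(pathP v) => i iq; have xy := pathP v vq i iq.
have last_take j : j <= size q -> last v (take j q) = nth v (v :: q) j.
  case: j => [|j] jq; first by rewrite take0.
  by rewrite (take_nth v) // last_rcons.
have split_walk j : j <= size q ->
    path adj v (take j q) /\ path adj (nth v (v :: q) j) (drop j q).
  by move=> jq; move: vq; rewrite -{1}(cat_take_drop j q) cat_path last_take // => /andP.
have [vx _] := split_walk i (ltnW iq); have [_ yv] := split_walk i.+1 iq.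
have [m dx mi] := walk_dist vx; rewrite last_take ?(ltnW iq)// in dx.
have [|n dy ni] := rev_walk_dist yv (_ : _ = v).
  by rewrite -[RHS]qv -[in RHS](cat_take_drop i.+1 q) last_cat (last_take i.+1).
apply: (ball_edge_dist dx dy) => //.
apply: leq_trans qr; rewrite size_take iq in mi; rewrite size_drop in ni.
by rewrite -addSn -(subnKC iq); apply: leq_add; rewrite ?ltnS.
Qed.

Lemma locally_chordal_short_cycles r X (c : seq G) : locally_chordal G r ->
  size c <= r -> (forall x, X x -> x \in c) -> chordal (induced X).
Proof.
move=> lcG cr Xc [//|v p] [p2 cp up] p4.
have pX : forall z, z \in v :: p -> X z.
  by move=> z zp; have /induced_edgeP[] := next_cycle cp zp.
have [|x [y [xp yp xy nx ny]]] := lcG v (v :: p) _ p4.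
  apply: cycle_in_ball.
    split=> //; move: cp; apply: sub_path => ? ? /induced_edgeP[]//.
  apply: leq_trans cr; apply: uniq_leq_size => // z /pX/Xc //.
exists x, y; split=> //; apply/induced_edgeP; split; [|exact: pX..].
exact: edge_adj xy.
Qed.

(** Neighbours of v have distance sum at most 2 < r, so all edges between them
    belong to the ball. *)
Lemma locally_chordal_nbhd r v : 3 <= r -> locally_chordal G r ->
  chordal (induced (closed_nbhd v)).
Proof.
move=> r3 lcG [//|u p] [p2 cp up] p4.
have cX : forall z, z \in u :: p -> closed_nbhd v z.
  by move=> z zp; have /induced_edgeP[] := next_cycle cp zp.
have dist1 z : closed_nbhd v z -> exists2 n, is_dist v z n & n <= 1.
  case=> [->|vz]; first by have [n] := @walk_dist v [::] isT; exists n => //; exact: leqW.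
  by apply: (@walk_dist v [:: z]); rewrite /= vz.
have [|x [y [xp yp xy nx ny]]] := lcG v (u :: p) _ p4.
  split=> //; move: cp; apply: sub_path => x y /induced_edgeP[xy].
  move=> /dist1[m dx m1] /dist1[n dy n1]; apply: (ball_edge_dist dx dy) => //.
  by apply: leq_ltn_trans r3; apply: (@leq_add m n 1 1).
exists x, y; split=> //; apply/induced_edgeP; split; [|exact: cX..].
exact: edge_adj xy.
Qed.

End Balls.

(** * Parity of closed walks across a local separation *)

Lemma set2_eq T (a b x y : T) : [set a; b] = [set x; y] ->
  (a = x /\ b = y) \/ (a = y /\ b = x).
Proof.
move=> eq_ab.
have : [set x; y] a by rewrite -eq_ab; left.
have : [set x; y] b by rewrite -eq_ab; right.
have : [set a; b] x by rewrite eq_ab; left.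
have : [set a; b] y by rewrite eq_ab; right.
by move=> [] /= ? [] /= ? [] /= ? [] /= ?; subst; auto.
Qed.

Lemma not_uniq_split (T : eqType) (p : seq T) : ~~ uniq p ->
  exists z p1 p2 p3, p = p1 ++ z :: p2 ++ z :: p3.
Proof.
elim: p => //= y p IH; rewrite negb_and negbK => /orP[/splitPr[p2 p3]|].
  by exists y, [::], p2, p3.
by move=> /IH[z [p1 [p2 [p3 ->]]]]; exists z, (y :: p1), p2, p3.
Qed.

Section WalkEdges.
Variable T : choiceType.
Implicit Types (x y : T) (p q : seq T).

Lemma walk_edges_cons x y p e :
  walk_edges x (y :: p) e <-> e = [set x; y] \/ walk_edges y p e.
Proof.
split=> [[[a b] /=]|[->|[z zp <-]]].
- rewrite inE => /predU1P[[-> ->] <-|abp <-]; first by left.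
  by right; exists (a, b).
- by exists (x, y); rewrite //= mem_head.
- by exists z => //=; rewrite inE zp orbT.
Qed.

Lemma walk_edges_cat x p q e :
  walk_edges x (p ++ q) e <-> walk_edges x p e \/ walk_edges (last x p) q e.
Proof.
elim: p x => [|y p IH] x /=.
  by split=> [|[[]|]]; [right | | ].
rewrite !walk_edges_cons IH; tauto.
Qed.

Lemma walk_edges_path (r : rel T) (Q : set (set T)) x p : path r x p ->
  (forall a b, a \in x :: p -> b \in x :: p -> r a b -> Q [set a; b]) ->
  walk_edges x p `<=` Q.
Proof.
elim: p x => [|y p IH] x; first by move=> _ _ e [].
move=> /= /andP[xy yp] rQ e /walk_edges_cons[->|]; first by apply: rQ => //; rewrite !inE eqxx ?orbT.
by apply: IH => // a b ap bp; apply: rQ; rewrite inE ?ap ?bp orbT.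
Qed.

Lemma closed_walk_cycle_edges x p : uniq (x :: p) ->
  walk_edges x (rcons p x) `<=` cycle_edges (x :: p).
Proof.
move=> up; apply: (@walk_edges_path (frel (next (x :: p)))).
  exact: (cycle_next up).
move=> a b ap _ /eqP <-; exists a => //=.
by move: ap; rewrite inE mem_rcons in_cons orbA orbb.
Qed.

End WalkEdges.

Section Parity.
Variables (T : eqType) (eps : rel T).
Hypothesis eps_sym : symmetric eps.
Implicit Types (x y : T) (p q : seq T).

Fixpoint parity x p : bool :=
  if p is y :: p' then eps x y (+) parity y p' else false.

Lemma parity_cat x p q :
  parity x (p ++ q) = parity x p (+) parity (last x p) q.
Proof. by elim: p x => //= y p IH x; rewrite IH addbA. Qed.

Lemma parity_rcons x p y :
  parity x (rcons p y) = parity x p (+) eps (last x p) y.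
Proof. by rewrite -cats1 parity_cat /= addbF. Qed.

Lemma parity_rev x p : parity (last x p) (rev (belast x p)) = parity x p.
Proof.
elim: p x => //= y p IH x; rewrite rev_cons parity_rcons IH last_rev_belast.
by rewrite addbC eps_sym.
Qed.

Lemma parity0 x p :
  (forall a b, a \in x :: p -> b \in x :: p -> eps a b = false) ->
  parity x p = false.
Proof.
elim: p x => //= y p IH x eps0; rewrite eps0 ?inE ?eqxx ?orbT //=.
by apply: IH => a b ap bp; apply: eps0; rewrite inE ?ap ?bp orbT.
Qed.

(** A closed walk that repeats a vertex splits into two shorter closed walks; one
    that does not is a cycle, or goes along an edge and back. *)
Lemma closed_walk_even (e : rel T) r : irreflexive e ->
  (forall x p, cycle e (x :: p) -> uniq (x :: p) -> 3 <= size (x :: p) <= r ->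
     parity x (rcons p x) = false) ->
  forall x p, path e x p -> last x p = x -> size p <= r -> parity x p = false.
Proof.
move=> e_irr cyc0 x p; have [n] := ubnP (size p); elim: n x p => // n IH x p.
rewrite ltnS => pn xp px pr; have [up|/not_uniq_split] := boolP (uniq p); last first.
  case=> z [p1 [p2 [p3 def_p]]].
  have ->: parity x p =
      parity x (p1 ++ z :: p3) (+) parity z (rcons p2 z).
    rewrite def_p !parity_cat /= parity_cat /= parity_rcons.
    by rewrite -!addbA; do 2!congr addb; rewrite [RHS]addbC addbA.
  move: xp px; rewrite def_p !cat_path /= cat_path !last_cat /= last_cat /=.
  case/and5P=> xp1 p1z zp2 p2z zp3 p3x.
  have sz : size p = (size p1 + size p3).+2 + size p2.
    by rewrite def_p !size_cat /= size_cat /=; lia.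
  rewrite !IH //.
  - by rewrite size_rcons; lia.
  - by rewrite rcons_path zp2.
  - by rewrite last_rcons.
  - by rewrite size_rcons; lia.
  - by rewrite size_cat /=; lia.
  - by rewrite cat_path /= xp1 p1z.
  - by rewrite last_cat.
  - by rewrite size_cat /=; lia.
case/lastP: p xp px pr up {pn} => [//|p y]; rewrite last_rcons => + yx.
rewrite {y}yx => xp pr up; rewrite size_rcons in pr.
have ux : uniq (x :: p) by rewrite cons_uniq -rcons_uniq.
case: p xp pr ux up => [|y [|z p]] xp pr ux up.
- by rewrite /= e_irr in xp.
- by rewrite /= addbF eps_sym addbb.
- exact: cyc0.
Qed.

End Parity.

Section LocalSeparationParity.
Variables (G : graph) (r : nat) (E0 E1 : set (set G)) (X : set G).
Hypothesis sepX : local_separation r E0 X E1.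

Let eps : rel G := fun x y => `[< E0 [set x; y] >].

Lemma eps_sym : symmetric eps.
Proof. by move=> x y; rewrite /eps setUC. Qed.

Lemma eps_boundary x y : eps x y -> (X x /\ ~ X y) \/ (~ X x /\ X y).
Proof.
move=> /asboolP E0xy; have: boundary X [set x; y].
  by case: sepX => -[_ <-] _; left.
case=> a [b [_ Xa nXb eq_xy]].
by have [[-> ->]|[-> ->]] := set2_eq eq_xy; [left | right].
Qed.

Lemma boundary_pair x y : adj x y -> X x -> ~ X y -> boundary X [set x; y].
Proof. by exists x, y. Qed.

(** Only the first and the last edge of the walk can be boundary edges, and
    locality puts both on the same side. *)
Lemma eps_same_side z q y : local_set_walk r X z (rcons q y) ->
  parity eps z (rcons q y) = false.
Proof.
move=> lw; have [[zq Xz Xy nX] _] := lw; rewrite last_rcons in Xy.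
case: q lw zq nX => [|a q] lw zq nX /=.
  by rewrite addbF; apply/negP => /eps_boundary[[_ /(_ Xy)]|[/(_ Xz)]].
have nXq b : b \in a :: q -> ~ X b.
  by move=> bq; apply: nX; rewrite belast_rcons.
rewrite parity_rcons; have -> : parity eps a q = false.
  apply: parity0 => b c /nXq nXb /nXq nXc.
  by apply/negP => /eps_boundary[[/nXb]|[_ /nXc]].
set b := last a q; have nXa := nXq a (mem_head _ _).
have nXb : ~ X b := nXq b (mem_last _ _).
move: zq; rewrite /= rcons_path => /and3P[za _ byy].
have walk_za : walk_edges z (rcons (a :: q) y) [set z; a].
  by apply/walk_edges_cons; left.
have walk_by : walk_edges z (rcons (a :: q) y) [set b; y].
  by rewrite -cats1; apply/walk_edges_cat; right; apply/walk_edges_cons; left.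
have bd_za := boundary_pair za Xz nXa.
have bd_by : boundary X [set b; y].
  by rewrite setUC; apply: boundary_pair; rewrite // adj_sym.
case: sepX => -[_ E01] /(_ _ _ lw) nsep; rewrite -E01 in bd_za bd_by.
apply/negbTE; rewrite /= negb_add; apply/eqP; apply/asboolP/asboolP => E0e.
  case: bd_by => // E1e; case: nsep; split; first by exists [set z; a].
  by exists [set b; y].
case: bd_za => // E1e; case: nsep; split; first by exists [set b; y].
by exists [set z; a].
Qed.

(** The walk is the concatenation of the X-walks between its consecutive visits
    to X. *)
Lemma eps_walk_on_cycle c z q : is_cycle adj c -> size c <= r ->
  path adj z q -> X z -> X (last z q) -> (forall t, t \in z :: q -> t \in c) ->
  walk_edges z q `<=` cycle_edges c -> parity eps z q = false.
Proof.
move=> cc cr; have [n] := ubnP (size q); elim: n z q => // n IH z q.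
rewrite ltnS => qn zq Xz Xq qc eqc.
case: q qn zq Xq qc eqc => // y0 q0 qn zq Xq qc eqc.
have hasX : has (mem X) (y0 :: q0).
  by apply/hasP; exists (last z (y0 :: q0)); [exact: (mem_last y0 q0) | exact/mem_set].
case/split_find: hasX qn zq Xq qc eqc => y q1 q2 /set_mem Xy nq1.
rewrite size_cat size_rcons cat_path last_cat last_rcons => qn /andP[zq1 yq2] Xq qc eqc.
rewrite parity_cat last_rcons (IH y q2) ?addbF //; last first.
- by move=> e eq2; apply: eqc; apply/walk_edges_cat; right; rewrite last_rcons.
- move=> t; rewrite inE => /predU1P[->|tq]; apply: qc.
    by rewrite inE mem_cat mem_rcons mem_head orbT.
  by rewrite inE mem_cat tq !orbT.
- by apply: leq_trans qn; rewrite addSn ltnS leq_addl.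
apply: eps_same_side; split.
  split; rewrite ?last_rcons // belast_rcons => t tq1 Xt.
  by case/hasP: nq1; exists t => //; exact/mem_set.
left; exists c; split=> //.
  move=> t tq; apply: qc; move: tq; rewrite !inE mem_cat => /orP[->//|->].
  by rewrite orbT.
by move=> e eq1; apply: eqc; apply/walk_edges_cat; left.
Qed.

Lemma cycle_even x p : is_cycle adj (x :: p) -> size (x :: p) <= r ->
  parity eps x (rcons p x) = false.
Proof.
move=> cx sx; have [p2 cp up] := cx.
have [/hasP[z zp /set_mem Xz]|noX] := boolP (has (mem X) (x :: p)); last first.
  have inp t : t \in x :: rcons p x -> ~ X t.
    rewrite inE mem_rcons in_cons orbA orbb => tp Xt.
    by case/hasP: noX; exists t; [rewrite inE | exact/mem_set].
  apply: parity0 => a b /inp nXa /inp nXb; apply/negbTE/negP.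
  by move=> /eps_boundary[[/nXa]|[_ /nXb]].
have [q [cq sq ->]] : exists q, [/\ is_cycle adj (z :: q),
    size (z :: q) = size (x :: p)
    & parity eps x (rcons p x) = parity eps z (rcons q z)].
  move: zp; rewrite inE => /predU1P[->|/splitPr def_p]; first by exists p.
  case: def_p {p2 sx cp up} cx => p1 p2 cx; exists (p2 ++ x :: p1); split.
  - have rot_p : rot (size (x :: p1)) (x :: p1 ++ z :: p2) = z :: p2 ++ x :: p1.
      by rewrite -cat_cons rot_size_cat.
    case: cx => s3 cc uc; rewrite -rot_p.
    by split; rewrite ?size_rot ?rot_cycle ?rot_uniq.
  - by rewrite /= !size_cat /= !addnS addnC.
  rewrite !rcons_cat !parity_cat /= !parity_rcons.
  set A := parity eps x p1; set B := parity eps z p2.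
  by case: A; case: B; case: (eps _ _); case: (eps _ _).
have [_ czq uzq] := cq; apply: (@eps_walk_on_cycle (z :: q)) => //.
- by rewrite sq.
- by rewrite last_rcons.
- by move=> t; rewrite !inE mem_rcons in_cons orbA orbb.
- exact: closed_walk_cycle_edges.
Qed.

Lemma short_closed_walk_even x p : path adj x p -> last x p = x -> size p <= r ->
  parity eps x p = false.
Proof.
apply: closed_walk_even; [exact: eps_sym | exact: adj_irr |].
by move=> {}x {}p cp up /andP[p3 pr]; apply: cycle_even.
Qed.

End LocalSeparationParity.

(** * From a decomposition into cliques to chordal balls *)

Section BallParity.
Variables (G : graph) (r : nat) (E0 E1 : set (set G)) (S : set G).
Hypothesis sepS : local_separation r E0 S E1.
Implicit Types (x y v : G).

Local Notation eps := (fun x y : G => `[< E0 [set x; y] >]).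

Lemma dist_unique v x m n : is_dist v x m -> is_dist v x n -> m = n.
Proof.
move=> [[p [vp px <-]] minm] [[q [vq qx <-]] minn].
by apply/eqP; rewrite eqn_leq minm // minn.
Qed.

Lemma parity_avoid x p : (forall z, z \in x :: p -> ~ S z) ->
  parity eps x p = false.
Proof.
move=> nS; apply: parity0 => a b /nS nSa /nS nSb.
by apply/negbTE/negP => /(eps_boundary sepS)[[/nSa]|[_ /nSb]].
Qed.

Definition geodesic v x : seq G :=
  xget [::] [set p | [/\ path adj v p, last v p = x & is_dist v x (size p)]].

Lemma geodesicP v x n : is_dist v x n ->
  [/\ path adj v (geodesic v x), last v (geodesic v x) = x
    & size (geodesic v x) = n].
Proof.
move=> dx; have [|vp px dp] := @xgetPex _ [::]
    [set p | [/\ path adj v p, last v p = x & is_dist v x (size p)]].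
  by have [[p [vp px pn]] _] := dx; exists p; split; rewrite ?pn.
by split=> //; exact: dist_unique dp dx.
Qed.

(** The left-hand walk goes from v to x along a geodesic, along the edge xy, and
    back to v along a geodesic. *)
Lemma parity_geodesics v x y m n : is_dist v x m -> is_dist v y n ->
  parity eps v (geodesic v x ++ y :: rev (belast v (geodesic v y))) =
  parity eps v (geodesic v x) (+) (eps x y (+) parity eps v (geodesic v y)).
Proof.
move=> /geodesicP[_ gx _] /geodesicP[_ gy _].
rewrite parity_cat gx /=; do 2!congr addb.
by rewrite -{1}gy parity_rev //; exact: eps_sym.
Qed.

Lemma geodesics_closed v x y m n : is_dist v x m -> is_dist v y n -> adj x y ->
  let w := geodesic v x ++ y :: rev (belast v (geodesic v y)) in
  [/\ path adj v w, last v w = v & size w = (m + n).+1].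
Proof.
move=> /geodesicP[px gx sx] /geodesicP[py gy sy] xy /=.
have := rev_walk py; have := last_rev_belast v (geodesic v y); rewrite gy => lw pw.
split; first by rewrite cat_path px gx /= xy.
  by rewrite last_cat.
by rewrite size_cat /= size_rev size_belast sx sy addnS.
Qed.

(** The parity of geodesics from v is a potential for E0: an edge of the ball and
    the geodesics to its ends form a closed walk of length at most r. *)
Lemma ball_edge_parity v x y : edge (ball r v) x y ->
  eps x y = parity eps v (geodesic v x) (+) parity eps v (geodesic v y).
Proof.
case/and4P=> xy _ _ /asboolP[m [n [dx dy mnr]]].
have [pw lw sw] := geodesics_closed dx dy xy.
have := short_closed_walk_even sepS pw lw; rewrite sw => /(_ mnr).
rewrite (parity_geodesics dx dy).
by case: (eps x y); do 2!case: (parity _ _ _).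
Qed.

Lemma ball_cycle_even v x p : cycle (edge (ball r v)) (x :: p) ->
  parity eps x (rcons p x) = false.
Proof.
pose pi z := parity eps v (geodesic v z).
have walk z q : path (edge (ball r v)) z q ->
    parity eps z q = pi z (+) pi (last z q).
  elim: q z => [|y q IH] z /=; first by rewrite addbb.
  case/andP=> zy /IH ->.
  have -> := ball_edge_parity (zy : edge (ball r v) z y).
  by rewrite -/(pi z) -/(pi y) addbA -[_ (+) _ (+) pi y]addbA addbb addbF.
by move=> /walk ->; rewrite last_rcons addbb.
Qed.

(** The closed walk from v to a, b, c and back to v has length 2(k + 1) at most r.
    Vertices of S other than b are adjacent to b, hence have distance at least k
    to v; so the two geodesics avoid S, and the walk can use E0 only at the edges
    ab and bc. *)
Lemma sphere_separation v a b c k : clique S -> S b -> ~ S a -> ~ S c ->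
  is_dist v b k.+1 -> is_dist v a k -> is_dist v c k -> k.+1.*2 <= r ->
  adj a b -> adj b c -> eps a b = eps b c.
Proof.
move=> cS Sb nSa nSc db da dc kr ab bc.
have avoid x p : path adj v p -> last v p = x -> size p = k -> ~ S x ->
    forall z, z \in v :: p -> ~ S z.
  move=> vp px pk nSx z /splitPl def_p Sz.
  case: def_p vp px pk => p1 p2 p1z; rewrite cat_path last_cat size_cat.
  case/andP=> vp1 _ px pk; have [_ minb] := db.
  have [zb|zb] := eqVneq z b.
    by have := minb p1 vp1; rewrite p1z zb => /(_ erefl); lia.
  have := minb (rcons p1 b); rewrite rcons_path vp1 last_rcons size_rcons p1z.
  rewrite (cS z b) // => /(_ isT erefl) kp1.
  rewrite ltnS -pk -{2}[size p1]addn0 leq_add2l leqn0 size_eq0 in kp1.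
  by apply: nSx; rewrite -px (eqP kp1) /= p1z.
have [pa ga sa] := geodesicP da; have [pc gc sc] := geodesicP dc.
pose w := geodesic v a ++ b :: c :: rev (belast v (geodesic v c)).
have := rev_walk pc; have := last_rev_belast v (geodesic v c); rewrite gc => lw pw.
have := @short_closed_walk_even _ _ _ _ _ sepS v w.
rewrite /w cat_path pa ga /= ab bc pw last_cat /= lw size_cat /= size_rev.
rewrite size_belast sa sc => /(_ isT erefl) H.
have {H} : parity eps v w = false by apply: H; lia.
rewrite /w parity_cat ga /=; have -> : parity eps c (rev (belast v (geodesic v c))) = false.
  by rewrite -{1}gc parity_rev ?(parity_avoid (avoid _ _ pc gc sc nSc)) //; exact: eps_sym.
rewrite (parity_avoid (avoid _ _ pa ga sa nSa)) addbF /=.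
by do 2!case: asbool.
Qed.

End BallParity.

Section DecompositionToChordal.
Variables (G H : graph) (V : H -> set G) (r : nat).
Hypothesis decV : graph_decomposition V.
Hypothesis cliqueV : into_cliques V.
Hypothesis locV : induces_local_separations r V.

(** No bag contains both a and c, since bags are cliques.
    On a path in H_b from a bag with a to a bag with c, the edge at which a is
    left for the last time induces the required separation. *)
Lemma separate_neighbours (a b c : G) :
  adj a b -> adj b c -> a != c -> ~~ adj a c ->
  exists E0 S E1, [/\ local_separation r E0 S E1, clique S,
    [/\ S b, ~ S a & ~ S c], E0 [set b; a] & E1 [set b; c]].
Proof.
move=> ab bc ac nac; have ba : adj b a by rewrite adj_sym.
have nab_bag h : V h a -> V h c -> False.
  by move=> ha hc; rewrite (cliqueV ha hc ac) in nac.
have [_ edgeV conV] := decV.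
have [h [ha hb]] := edgeV _ _ ab; have [k [kb kc]] := edgeV _ _ bc.
have [_ /(_ h k hb kb)[_ [p hp pk]]] := conV b.
have [h0 [h1 [q [h0a h0h1 hq qk nqa]]]] : exists h0 h1 q,
    [/\ V h0 a, edge (copart V b) h0 h1, path (edge (copart V b)) h1 q,
        last h1 q = k & forall t, t \in h1 :: q -> ~ V t a].
  have: exists2 t, t \in h :: p & V t a by exists h; rewrite ?mem_head.
  (* The invariant only asks for some bag with a on the path, which makes the last
     such bag accessible to induction from the front. *)
  elim: p h {ha hb} hp pk => [|k' p IH] h hp pk exa.
    case: exa => t; rewrite mem_seq1 => /eqP-> ha; case: (nab_bag h) => //.
    by rewrite [h]pk.
  move: hp => /andP[hk' k'p].
  have [exa'|nexa] := pselect (exists2 t, t \in k' :: p & V t a).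
    exact: IH k'p pk exa'.
  exists h, k', p; split=> //; last by move=> t tp ta; apply: nexa; exists t.
  case: exa => t; rewrite in_cons => /predU1P[->//|tp ta].
  by case: nexa; exists t.
have [h0h1' h0b h1b] := induced_edgeP _ _ _ h0h1.
have nh1a : ~ V h1 a := nqa h1 (mem_head _ _).
have Sb : adhesion V h0 h1 b by split.
have Sa : ~ adhesion V h0 h1 a by case.
have Sc : ~ adhesion V h0 h1 c by case=> /(nab_bag h0).
have [_ _ /(_ _ _ h0h1') sep] := locV.
exists (side_edges V h0 h1), (adhesion V h0 h1), (side_edges V h1 h0).
split=> //.
- by apply: clique_subset (@cliqueV h0) => ? [].
- exists b => //; split; first by exists b, a.
  by exists a, h0; split=> //; apply: component_refl.
- exists b; first by rewrite /adhesion setIC.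
  split; first by exists b, c; split=> //; rewrite /adhesion setIC.
  exists c, k; split=> //; split=> //; exists q => //.
  apply: (sub_in_path (P := fun t => `[< ~ V t a >])) hq; last first.
    by apply/allP => t tq; apply/asboolP/nqa.
  move=> x y /asboolP nx /asboolP ny xy; apply/and3P; split=> //.
    by apply: contra_not_neq ny => -[_ ->].
  by apply: contra_not_neq nx => -[->].
Qed.

Lemma decomposition_locally_chordal : locally_chordal G r.
Proof.
move=> v c [c3 cc uc] c4.
have distc x : x \in c -> exists2 m, is_dist v x m & m.*2 <= r.
  by move=> /(next_cycle cc) /and4P[_ /set_mem].
(* A vertex at distance r/2, if the cycle has one, is chosen as b; otherwise the
   cycle spans the same edges in the ball as in G. *)
pose top x := exists2 m, is_dist v x m & m.*2 = r.
have [b [bc Hb]] : exists b, b \in c /\ (top b \/ forall x, x \in c -> ~ top x).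
  have [[b [bc tb]]|notop] := pselect (exists b, b \in c /\ top b).
    by exists b; split=> //; left.
  have [x xc] : exists x, x \in c by case: (c) c3 => // x ? _; exists x; exact: mem_head.
  exists x; split=> //.
  by right=> z zc tz; apply: notop; exists z.
have [i p def_c] := rot_to bc.
have {}c4 : 4 <= size (b :: p) by rewrite -def_c size_rot.
have {}uc : uniq (b :: p) by rewrite -def_c rot_uniq.
have {}cc : cycle (edge (ball r v)) (b :: p) by rewrite -def_c rot_cycle.
have memc z : z \in c = (z \in b :: p) by rewrite -def_c mem_rot.
have nextc z : next c z = next (b :: p) z by rewrite -def_c next_rot // -(rot_uniq i) def_c.
(* From now on the cycle is read from b on. *)
suff [x [y [xc yc xy nx ny]]] : exists x y, [/\ x \in b :: p, y \in b :: p,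
    edge (ball r v) x y, y != next (b :: p) x & x != next (b :: p) y].
  by exists x, y; rewrite !memc !nextc.
have {}notop : top b \/ (forall x, x \in b :: p -> ~ top x).
  by case: Hb => [|nt]; [left | right=> x; rewrite -memc; apply: nt].
have {}distc x : x \in b :: p -> exists2 m, is_dist v x m & m.*2 <= r.
  by rewrite -memc; apply: distc.
case: p {def_c memc nextc Hb bc c3 c i} c4 uc cc notop distc =>
  [|z0 [|z1 [|z2 p]]] // _ uc cc notop distc.
set c := [:: b, z0, z1, z2 & p] in uc cc notop distc *.
set a := last z2 p.
have ac : a \in c by rewrite /a !inE -in_cons mem_last !orbT.
have z0c : z0 \in c by rewrite !inE eqxx orbT.
have next_a : next c a = b.
  rewrite next_nth ac [index _ _](_ : _ = size [:: z0, z1, z2 & p]).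
    by rewrite /c nth_default.
  exact: (index_last uc).
have next_b : next c b = z0 by rewrite next_nth mem_head /c /= eqxx.
have next_z0 : next c z0 = z1.
  have bz0 : b != z0.
    by case/andP: uc => + _; apply: contraNneq => ->; exact: mem_head.
  by rewrite next_nth z0c /c /= (negbTE bz0) eqxx.
have eab : edge (ball r v) a b by rewrite -next_a; exact: next_cycle.
have ebz : edge (ball r v) b z0 by rewrite -next_b; apply: next_cycle; rewrite ?mem_head.
have az0 : a != z0.
  case/and4P: uc => _ + _ _; apply: contraNneq => <-.
  by rewrite inE mem_last orbT.
have topb_dist m x : is_dist v b m -> m.*2 = r ->
    edge (ball r v) x b -> exists2 k, m = k.+1 & is_dist v x k.
  move=> db mr /and4P[xb _ _ /asboolP[n [m' [dx db' nm]]]].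
  have := dist_unique db db' => eqm; rewrite -eqm in nm.
  have bx : adj b x by rewrite adj_sym.
  have := dist_adj db dx bx => mn; exists n => //; lia.
have notop_edge x y : (forall x, x \in c -> ~ top x) -> x \in c -> y \in c ->
    adj x y -> edge (ball r v) x y.
  move=> nt xc yc; have [m dx mr] := distc x xc; have [n dy nr] := distc y yc.
  apply: (ball_edge_dist dx dy).
  have : m.*2 <> r by move=> mr'; apply: (nt x xc); exists m.
  have : n.*2 <> r by move=> nr'; apply: (nt y yc); exists n.
  lia.
have [eaz|neaz] := boolP (edge (ball r v) a z0).
  exists a, z0; split=> //.
    rewrite next_a; apply: contraTneq ebz => ->.
    by apply/negP => /edge_adj; rewrite adj_irr.
  rewrite next_z0; case/and4P: uc => _ _ + _; apply: contraNneq => <-.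
  exact: mem_last.
have ab := edge_adj eab; have bz := edge_adj ebz; have zb := bz; rewrite adj_sym in zb.
have nadj : ~~ adj a z0.
  apply: contra neaz => az; case: notop => [[m db mr]|nt]; last exact: notop_edge.
  have [k mk da] := topb_dist _ _ db mr eab.
  rewrite edge_sym in ebz; have [k' mk' dz] := topb_dist _ _ db mr ebz.
  by apply: (ball_edge_dist da dz) => //; lia.
have [E0 [S [E1 [sepS cS [Sb nSa nSz] E0ba E1bz]]]] := separate_neighbours ab bz az0 nadj.
have eps_ab : `[< E0 [set a; b] >] = true by rewrite setUC; apply/asboolP.
have eps_bz : `[< E0 [set b; z0] >] = false.
  apply/asboolP => E0bz; have [[E01 _] _] := sepS.
  by have : (E0 `&` E1) [set b; z0] by []; rewrite E01.
case: notop => [[m db mr]|nt].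
  have [k mk da] := topb_dist _ _ db mr eab.
  rewrite edge_sym in ebz; have [k' mk' dz] := topb_dist _ _ db mr ebz.
  have kk : k' = k by lia.
  rewrite mk in db mr; rewrite kk in dz.
  have := sphere_separation sepS cS Sb nSa nSz db da dz _ ab bz.
  by rewrite eps_ab eps_bz mr => /(_ (leqnn _)).
(* A second vertex t of the cycle in S is adjacent to b, and bt is a chord because
   neither a nor z0 lies in S. *)
have [[t tc St]|noS] := pselect (exists2 t, t \in [:: z0, z1, z2 & p] & S t).
  have bt : b != t by case/andP: uc => + _; apply: contraNneq => ->.
  have {}tc : t \in c by rewrite inE tc orbT.
  exists b, t; split=> //; rewrite ?mem_head //.
  - by apply: notop_edge => //; [exact: mem_head | exact: cS].
  - by rewrite next_b; apply: contra_not_neq nSz => <-.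
  - apply: contra_not_neq nSa => /esym tb; rewrite -(_ : t = a) //.
    by apply: (can_inj (prev_next uc)); rewrite next_a.
(* Now b is the only vertex of the cycle in S, so of its edges only those at b can
   lie in E0, and exactly one of them does. *)
have := ball_cycle_even sepS cc; rewrite parity_rcons [last _ _]/= -/a eps_ab.
rewrite [parity _ _ _]/= -/(parity _ z0 [:: z1, z2 & p]) eps_bz.
have nS z : z \in z0 :: [:: z1, z2 & p] -> ~ S z by move=> zp Sz; apply: noS; exists z.
by have /= -> := parity_avoid sepS nS.
Qed.

End DecompositionToChordal.

(** * Graphs on families of cliques *)

Lemma seq_argmin (T : eqType) (f : T -> nat) (s : seq T) x0 : x0 \in s ->
  exists2 x, x \in s & forall y, y \in s -> f x <= f y.
Proof.
move=> x0s; have exn : exists n, has (fun x => f x == n) s.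
  by exists (f x0); apply/hasP; exists x0.
case: (ex_minnP exn) => n /hasP[x xs /eqP <-] minx; exists x => // y ys.
by apply: minx; apply/hasP; exists y.
Qed.

Section CliqueGraph.
Variables (G : graph) (P : set (set G)).
Variables (root : set G -> set G) (rep : set G -> set G -> set G).

Local Notation comp S x := (component (induced (link S)) x).

(** The edges associated with the clique S form a star: its centre is root S and
    its leaves are chosen one for each component of the link of S that root S does
    not already meet. *)
Definition star_edge (S K K' : set G) : Prop := exists x,
  [/\ clique S, S !=set0, link S x, ~ (root S `&` comp S x !=set0)
    & K = root S /\ K' = rep S (comp S x)].

Let node := {K : set G | `[< P K >]}.

(** Irreflexivity is imposed by hand so that the graph makes sense for arbitrary
    choices of root and rep. *)
Definition clique_graph_adj : rel node := fun h k =>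
  (h != k) && `[< exists S, star_edge S (val h) (val k) \/
                            star_edge S (val k) (val h) >].

Lemma clique_graph_adj_sym : symmetric clique_graph_adj.
Proof.
move=> h k; rewrite /clique_graph_adj eq_sym; congr andb.
by apply/asboolP/asboolP => -[S []]; exists S; [right|left|right|left].
Qed.

Lemma clique_graph_adj_irr : irreflexive clique_graph_adj.
Proof. by move=> h; rewrite /clique_graph_adj eqxx. Qed.

Definition clique_graph : graph :=
  Graph clique_graph_adj_sym clique_graph_adj_irr.

Definition clique_bag (h : clique_graph) : set G := val h.

Hypothesis finG : locally_finite G.
Hypothesis chG : forall v : G, chordal (induced (closed_nbhd v)).
Hypothesis cliqueP : forall K, P K -> clique K.
Hypothesis rootP : forall S, clique S -> S !=set0 -> P (root S) /\ S `<=` root S.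
Hypothesis root_id : forall S, P S -> S !=set0 -> root S = S.
Hypothesis repP : forall S x, clique S -> S !=set0 -> link S x ->
  [/\ P (rep S (comp S x)), S `<=` rep S (comp S x)
    & rep S (comp S x) `&` comp S x !=set0].

Implicit Types (h k : clique_graph) (S K X : set G) (x y z v : G).

Lemma bag_clique h : clique (clique_bag h).
Proof. by apply: cliqueP; apply/asboolP; exact: (valP h). Qed.

Lemma bagP h : P (clique_bag h).
Proof. by apply/asboolP; exact: (valP h). Qed.

Definition mk_node K (PK : P K) : clique_graph := Sub K (asboolT PK).

(** The vertices of K outside S lie in the link and are pairwise adjacent. *)
Lemma clique_in_component S K x y : clique K -> S `<=` K -> K y -> comp S x y ->
  K `\` S `<=` comp S x.
Proof.
move=> cK SK Ky xy z Kz; apply: (component_trans xy).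
apply: (clique_component (X := link S) (K := K `\` S)) => //.
- by apply: clique_subset cK => ? [].
- exact: clique_diff_link.
- by split=> //; have [] := component_vset xy.
Qed.

Lemma star_adhesion S K K' : star_edge S K K' -> K `&` K' = S.
Proof.
move=> [x [cS S0 lx nroot [-> ->]]]; have [Prep Srep [y [repy xy]]] := repP cS S0 lx.
have [_ Sroot] := rootP cS S0.
apply/seteqP; split=> z; last by move=> Sz; split; [exact: Sroot | exact: Srep].
move=> [rz pz]; apply: contrapT => nSz; apply: nroot; exists z; split=> //.
by apply: (clique_in_component _ _ repy xy) => //; apply: cliqueP.
Qed.

Lemma finite_nbhd v : exists l : seq G, forall z, closed_nbhd v z -> z \in l.
Proof.
have /finite_seqP[l Gl] := finG v; exists (v :: l) => z [->|vz].
  exact: mem_head.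
by rewrite inE; apply/orP; right; have: [set` l] z by rewrite -Gl.
Qed.

(** Every node h containing X is connected to root X.  If h is strictly larger
    than X, a vertex of h outside X lies in some component of the link of X, and so
    does a vertex of root X or of the leaf adjacent to it.  Along a path in that
    component, consecutive vertices together with X form a clique contained in a
    node, and the nodes containing X and one further vertex are connected by
    induction. *)
Lemma clique_graph_connected v X h k : clique X -> X v ->
  X `<=` clique_bag h -> X `<=` clique_bag k ->
  component (induced [set k | X `<=` clique_bag k]) h k.
Proof.
have [l ln] := finite_nbhd v.
have [n] := ubnP (count (fun u => u \in ~` X) l).
elim: n X h k => // n IH X h k; rewrite ltnS => Xn cX Xv.
have X0 : X !=set0 by exists v.
have [Proot Xroot] := rootP cX X0.
set A := induced [set k | X `<=` clique_bag k].
have step x h' k' : link X x -> X `<=` clique_bag h' -> X `<=` clique_bag k' ->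
    clique_bag h' x -> clique_bag k' x -> component A h' k'.
  move=> lx Xh Xk hx kx; have [nXx _] := lx.
  have sub k1 : X `<=` clique_bag k1 -> clique_bag k1 x ->
      X `|` [set x] `<=` clique_bag k1 by move=> Xk1 k1x z [/Xk1|->].
  apply: component_induced_sub (IH (X `|` [set x]) h' k' _ _ _ (sub _ Xh hx) (sub _ Xk kx)).
  - by move=> k1 Xk1 z Xz; apply: Xk1; left.
  - apply: leq_trans Xn; apply: (@count_mem_lt _ _ _ _ x) => //.
    + by move=> z nz Xz; apply: nz; left.
    + by move=> /(_ (or_intror erefl)).
    + by apply: ln; case: (link_sub_nbhd Xv lx).
  - exact: clique_link.
  - by left.
have walk x y h' k' : link X x -> comp X x y -> X `<=` clique_bag h' ->
    X `<=` clique_bag k' -> clique_bag h' x -> clique_bag k' y -> component A h' k'.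
  move=> lx xy Xh Xk hx; move: y xy k' Xk; apply: component_ind.
    by move=> k' Xk kx; exact: step hx kx.
  move=> y z xy IHy /induced_edgeP[yz ly lz] k' Xk kz.
  have cXyz := clique_link2 cX ly lz yz.
  have [|Pr rsub] := rootP cXyz; first by exists y; left; right.
  have Xr : X `<=` clique_bag (mk_node Pr) by move=> t Xt; apply: rsub; left; left.
  apply: (component_trans (IHy (mk_node Pr) Xr _)).
    by apply: rsub; left; right.
  by apply: (step z) => //; apply: rsub; right.
have to_root h' : X `<=` clique_bag h' -> component A h' (mk_node Proot).
  move=> Xh; have [[x hx nXx]|noX] := pselect (exists2 x, clique_bag h' x & ~ X x); last first.
    have hX : clique_bag h' = X.
      by apply/seteqP; split=> // x hx; apply: contrapT => nXx; apply: noX; exists x.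
    have -> : mk_node Proot = h'.
      by apply: val_inj => /=; rewrite root_id // -hX; exact: bagP.
    exact: component_refl.
  have lx : link X x by apply: (clique_diff_link (bag_clique (h := h')) Xh).
  have [[y [ry xy]]|nroot] := pselect (root X `&` comp X x !=set0).
    exact: (walk x y).
  have [Prep Xrep [y [repy xy]]] := repP cX X0 lx.
  apply: (component_trans (walk x y h' (mk_node Prep) lx xy Xh Xrep hx repy)).
  apply: component_edge; apply/induced_edgeP; split=> //.
  apply/andP; split; last first.
    by apply/asboolP; exists X; right; exists x.
  by apply: contra_not_neq nroot => /(congr1 val) /= <-; exists y.
move=> Xh Xk; apply: (component_trans (to_root h Xh)).
by apply: component_sym; apply: to_root.
Qed.

Lemma component_link_of_bag v S x K y : clique S -> S v -> link S x -> clique K -> S `<=` K ->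
  K y -> component (induced (closed_nbhd v `\` S)) x y -> comp S x y.
Proof.
move=> cS Sv lx cK SK Ky xy; apply: (@link_component G v) => //.
  have [l ln] := finite_nbhd v.
  apply: (@sub_finite_set _ _ [set` l]); last by apply/finite_seqP; exists l.
  by move=> z Sz; apply: ln; exact: (clique_sub_nbhd cS Sv).
apply: (clique_diff_link cK SK); split=> //.
by have [] := component_vset xy.
Qed.

(** Walk from k towards t without using h again, every bag keeping a vertex in the
    component of x outside S.  An adhesion set not contained in S preserves this
    property.  Any other edge belongs to the star of S.  It cannot start at the root,
    whose bag avoids the component of x, so it leads from the leaf of that component,
    which is h, directly to t; this is excluded by the last hypothesis.  Nor can the
    walk end in t, as t is the root. *)
Lemma no_path_around_star_edge v S x (e' : rel clique_graph) (t h : clique_graph) :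
  clique S -> S v -> link S x -> ~ (root S `&` comp S x !=set0) ->
  clique_bag t = root S -> clique_bag h = rep S (comp S x) ->
  (forall a b, e' a b -> [/\ adj a b, clique_bag a v, clique_bag b v
     & clique_bag a `&` clique_bag b `<=` S -> clique_bag a `&` clique_bag b = S]) ->
  forall q k, path e' k q -> last k q = t -> h \notin q ->
  clique_bag k `&` component (induced (closed_nbhd v `\` S)) x !=set0 ->
  (k = h -> forall q', q <> t :: q') -> False.
Proof.
move=> cS Sv lx nroot tE hE e'P.
have S0 : S !=set0 by exists v.
have [Proot Sroot] := rootP cS S0.
have not_root k y : clique_bag k = root S -> clique_bag k y ->
    component (induced (closed_nbhd v `\` S)) x y -> False.
  move=> kE ky xy; apply: nroot; exists y; rewrite -kE; split=> //.
  by apply: (component_link_of_bag (v := v) (K := clique_bag k)) => //; rewrite kE //; exact: cliqueP.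
elim=> [|k' q IH] k /=; first by move=> _ kt _ [y [ky xy]] _; apply: (not_root k y) => //; rewrite kt.
case/andP=> kk' k'q qt; rewrite inE negb_or eq_sym => /andP[k'h hq] [y [ky xy]] nkt.
have [adjkk kv k'v capS] := e'P _ _ kk'.
have [sub|nsub] := pselect (clique_bag k `&` clique_bag k' `<=` S); last first.
  have [z [kz k'z] nSz] : exists2 z, (clique_bag k `&` clique_bag k') z & ~ S z.
    apply: contrapT => noz; apply: nsub => z kz; apply: contrapT => nSz.
    by apply: noz; exists z.
  apply: (IH k') => //; last by move=> eqk; rewrite eqk eqxx in k'h.
  exists z; split=> //; apply: (component_trans xy).
  apply: (clique_component (K := clique_bag k `\` S)) => //.
  - by apply: clique_subset (bag_clique (h := k)) => ? [].
  - by move=> u [ku nSu]; split=> //; exact: (clique_sub_nbhd (bag_clique (h := k)) kv).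
  - by split=> //; have [] := component_vset xy.
have /andP[_ /asboolP[S' star]] := adjkk.
have S'S : S' = S.
  rewrite -(capS sub); case: star => /star_adhesion => [<-//|].
  by rewrite setIC => <-.
rewrite {}S'S in star; case: star => -[x' [_ _ lx' _ [kE k'E]]]; first exact: not_root ky xy.
have [Prep Srep [y' [ry' xy']]] := repP cS S0 lx'.
have Sk : S `<=` clique_bag k by rewrite [clique_bag k]k'E.
have xyC : comp S x y.
  by apply: (component_link_of_bag (v := v) (K := clique_bag k)) => //; exact: bag_clique.
have x'y : comp S x' y.
  rewrite -[rep _ _]k'E in ry'.
  apply: (clique_in_component (bag_clique (h := k)) Sk ry' xy'); split=> //.
  by have [] := component_vset xy.
have kh : k = h.
  apply: val_inj; rewrite -/(clique_bag k) -/(clique_bag h) hE [clique_bag k]k'E.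
  by rewrite (component_induced_eq xyC) (component_induced_eq x'y).
have k't : k' = t by apply: val_inj; rewrite -/(clique_bag t) tE; exact: kE.
by apply: (nkt kh q); rewrite k't.
Qed.

(** At an edge of the cycle with smallest adhesion set S, the other edges of the
    cycle have adhesion sets equal to S or not contained in S, which is what
    [no_path_around_star_edge] excludes. *)
Lemma clique_graph_acyclic v c : ~ is_cycle (edge (copart clique_bag v)) c.
Proof.
case=> c3 cc uc; have [l ln] := finite_nbhd v.
pose f (h k : clique_graph) := count (fun u => u \in clique_bag h `&` clique_bag k) l.
have fC h k : f h k = f k h by rewrite /f setIC.
have [c0 c0c] : exists c0, c0 \in c by case: (c) c3 => // z ? _; exists z; exact: mem_head.
have [m mc minm] := seq_argmin (fun k => f k (next c k)) c0c.
set m' := next c m in minm.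
(* The minimality of the adhesion set of mm' is made part of the edge relation, so
   that it survives rotation and reversal of the cycle. *)
pose e' : rel clique_graph := fun a b => edge (copart clique_bag v) a b && (f m m' <= f a b).
have e'sym : symmetric e' by move=> a b; rewrite /e' (edge_sym (copart clique_bag v)) (fC a b).
have ce' : cycle e' c.
  apply: cycle_from_next => // a ac; apply/andP; split; first exact: next_cycle.
  exact: minm.
have mm' : edge (copart clique_bag v) m m' by apply: next_cycle.
have [adjm mv m'v] := induced_edgeP _ _ _ mm'.
have /andP[_ /asboolP[S star]] := adjm.
have capS : clique_bag m `&` clique_bag m' = S.
  by case: star => /star_adhesion //; rewrite setIC.
(* The orientation of the cycle is normalised so that the edge leads from the
   root t to the leaf h; the opposite case is the reversed cycle. *)
have main c' h t : perm_eq c' c -> cycle e' c' -> next c' t = h -> t \in c' ->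
    star_edge S (clique_bag t) (clique_bag h) -> False.
  move=> cc' ec' th tc' [x [cS S0 lx nroot [tE hE]]].
  have hc' : h \in c' by rewrite -th mem_next.
  have [i q def_c] := rot_to hc'.
  have uq : uniq (h :: q) by rewrite -def_c rot_uniq (perm_uniq cc').
  have q2 : 2 <= size q.
    by have := size_rot i c'; rewrite def_c (perm_size cc') /= => sq; rewrite -ltnS sq.
  have eq' : path e' h (rcons q h) by rewrite -[path _ _ _]/(cycle e' (h :: q)) -def_c rot_cycle.
  have qt : last h q = t.
    have uc' : uniq c' by rewrite (perm_uniq cc').
    apply: (can_inj (prev_next uc')); rewrite th -(next_rot i) // def_c.
    by rewrite next_nth mem_last (index_last uq) nth_default.
  have Sv : S v by rewrite -capS.
  move: eq'; rewrite rcons_path => /andP[hq _].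
  apply: (no_path_around_star_edge cS Sv lx nroot tE hE _ hq qt).
  - move=> a b /andP[/induced_edgeP[ab av bv] fab]; split=> // abS.
    apply/seteqP; split=> // z Sz; apply: contrapT => nabz.
    have := count_mem_lt abS Sz nabz (ln z (clique_sub_nbhd cS Sv Sz)).
    by rewrite ltnNge -/(f a b); move: fab; rewrite {1}/f capS => ->.
  - by case/andP: uq.
  - have [_ _ [y [ry xy]]] := repP cS S0 lx; exists y; rewrite hE; split=> //.
    exact: component_induced_sub (link_sub_nbhd Sv) xy.
  - move=> _ q' qq'; move: q2 uq qt; rewrite qq' /= => q2 /and3P[_ + _] qt.
    by case: q' q2 qt {qq'} => //= a q' _ <-; rewrite mem_last.
case: star => star; first by apply: (main c m' m).
apply: (main (rev c) m m'); rewrite ?perm_rev ?mem_rev ?mem_next //.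
- by rewrite rev_cycle (eq_cycle (e' := e')) // => a b; rewrite e'sym.
- by rewrite next_rev // prev_next.
Qed.

Lemma clique_graph_covers X : clique X -> X !=set0 ->
  exists h, X `<=` clique_bag h.
Proof. by move=> cX /(rootP cX)[Pr Xr]; exists (mk_node Pr). Qed.

Lemma clique_graph_decomposition : graph_decomposition clique_bag.
Proof.
split=> [v|u v uv|v].
- by have [|h hv] := clique_graph_covers (@clique1 G v); [exists v | exists h; exact: hv].
- have [|h huv] := clique_graph_covers (clique2 uv); first by exists u; left.
  by exists h; split; apply: huv; [left|right].
split.
  by have [|h hv] := clique_graph_covers (@clique1 G v); [exists v | exists h; exact: hv].
move=> h k hv kv.
have subv k' : clique_bag k' v -> [set v] `<=` clique_bag k' by move=> k'v z ->.
apply: component_induced_sub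
  (clique_graph_connected (@clique1 G v) erefl (subv _ hv) (subv _ kv)).
by move=> k' /(_ v); apply.
Qed.

Lemma clique_graph_trees v : is_tree (copart clique_bag v).
Proof.
split; last exact: clique_graph_acyclic.
by have [] := clique_graph_decomposition.
Qed.

Lemma clique_graph_edge_connected u v : adj u v -> connected_subgraph
  (inter_subgraph (copart clique_bag u) (copart clique_bag v)).
Proof.
move=> uv; split.
  have [|h huv] := clique_graph_covers (clique2 uv); first by exists u; left.
  by exists h; split; apply: huv; [left|right].
move=> h k [hu hv] [ku kv].
have subuv k' : clique_bag k' u -> clique_bag k' v ->
  [set u; v] `<=` clique_bag k' by move=> k'u k'v z [->|->].
apply: component_sub (clique_graph_connected (clique2 uv) (or_introl erefl)
  (subuv _ hu hv) (subuv _ ku kv)).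
  by move=> k' uvk; split; apply: uvk; [left|right].
move=> a b /induced_edgeP[ab auv buv]; apply/andP; split; apply/induced_edgeP.
  by split=> //; [apply: auv; left | apply: buv; left].
by split=> //; [apply: auv; right | apply: buv; right].
Qed.

End CliqueGraph.

(** * The separations induced by the edges *)

Section EdgeDeletion.
Variables (H : graph) (A : subgraph H).
Implicit Types (a b x y : H).

Lemma del_edgeP a b x y : reflect
  [/\ edge A x y, ~ (x = a /\ y = b) & ~ (x = b /\ y = a)]
  (edge (del_edge A a b) x y).
Proof.
apply: (iffP and3P) => -[xy ab ba]; split=> //.
- by move=> [xa yb]; case/eqP: ab; rewrite xa yb.
- by move=> [xb ya]; case/eqP: ba; rewrite xb ya.
- by apply/eqP => -[xa yb]; apply: ab.
- by apply/eqP => -[xb ya]; apply: ba.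
Qed.

Lemma del_edge_flip a b x y :
  component (del_edge A a b) x y -> component (del_edge A b a) x y.
Proof.
by apply: component_sub => // u w /del_edgeP[uw nab nba]; apply/del_edgeP; split.
Qed.

(** A path from a to b avoiding the edge ab would close up to a cycle. *)
Lemma acyclic_bridge a b : (forall c, ~ is_cycle (edge A) c) -> edge A a b ->
  ~ component (del_edge A a b) a b.
Proof.
move=> acyc ab [_ [p ap pb]]; move: pb; case/shortenP: ap => {}p ap up _ pb.
case: p ap up pb => [|c [|d p]] ap up pb.
- by move: (edge_adj ab); rewrite -[b]pb adj_irr.
- by move: ap; rewrite /path andbT => /del_edgeP[_ + _]; case.
apply: (acyc (a :: c :: d :: p)); split=> //; rewrite [cycle _ _]/cycle rcons_path.
apply/andP; split; last by rewrite pb edge_sym.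
by apply: sub_path ap => x y /del_edgeP[].
Qed.

Lemma component_del_edge a b x : edge A a b -> component A a x ->
  component (del_edge A a b) a x \/ component (del_edge A b a) b x.
Proof.
move=> ab; move: x; apply: component_ind.
  by left; apply: component_refl; exact: edge_vset ab.
move=> x y _ ax xy; have [[_ ->]|nab] := pselect (x = a /\ y = b).
  by right; apply: component_refl; rewrite edge_sym in ab; exact: edge_vset ab.
have [[_ ->]|nba] := pselect (x = b /\ y = a).
  by left; apply: component_refl; exact: edge_vset ab.
case: ax => ax; [left|right]; apply: (component_trans ax);
  by apply: component_edge; apply/del_edgeP.
Qed.

End EdgeDeletion.

Section InducedSeparations.
Variables (G H : graph) (V : H -> set G).
Hypothesis treeV : forall v, is_tree (copart V v).
Hypothesis edgeV : forall u v, adj u v ->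
  connected_subgraph (inter_subgraph (copart V u) (copart V v)).
Hypothesis cliqueV : into_cliques V.
Hypothesis coverV : forall X, clique X -> X !=set0 -> exists h, X `<=` V h.

Section OneEdge.
Variables h0 h1 : H.
Hypothesis h01 : adj h0 h1.
Implicit Types (u v w : G) (h k : H).

Local Notation S := (adhesion V h0 h1).
Local Notation side v := (component (del_edge (copart V v) h0 h1) h0).
Local Notation coside v := (component (del_edge (copart V v) h1 h0) h1).

Lemma copart_edge v : S v -> edge (copart V v) h0 h1.
Proof. by case=> vh0 vh1; apply/induced_edgeP. Qed.

Lemma side_cover v h : S v -> V h v -> side v h \/ coside v h.
Proof.
move=> Sv hv; apply: component_del_edge; first exact: copart_edge.
by have [[_ con] _] := treeV v; apply: con => //; case: Sv.
Qed.

Lemma side_disjoint v h : S v -> side v h -> coside v h -> False.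
Proof.
move=> Sv s0 s1; have [_ acyc] := treeV v.
apply: (acyclic_bridge acyc (copart_edge Sv)).
by apply: (component_trans s0); apply: component_sym; apply: del_edge_flip.
Qed.

(** The nodes containing both v and w induce a connected graph, and as w is
    outside the adhesion set this graph does not contain the edge h0h1. *)
Lemma outside_same_component v w h k : adj v w -> ~ S w ->
  V h v -> V h w -> V k v -> V k w ->
  component (del_edge (copart V v) h0 h1) h k.
Proof.
move=> vw nSw hv hw kv kw; have [_ con] := edgeV vw.
apply: component_sub (con h k _ _) => //; first by move=> ? [].
move=> a b /andP[ab /induced_edgeP[_ aw bw]]; apply/del_edgeP.
by split=> // -[eqa eqb]; apply: nSw; rewrite -?eqa -?eqb; split.
Qed.

Lemma side_edgesP v w : adj v w -> S v -> ~ S w ->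
  side_edges V h0 h1 [set v; w] <-> exists2 h, V h w & side v h.
Proof.
move=> vw Sv nSw; split=> [[v' Sv' [_ [w' [h [eqe hw vh]]]]]|[h hw vh]].
  have [[vv ww]|[_ wv]] := set2_eq eqe; first by exists h; rewrite ?vv ?ww.
  by case: nSw; rewrite wv.
exists v => //; split; last by exists w, h.
by exists v, w.
Qed.

Lemma side_boundary e : side_edges V h0 h1 e -> boundary S e.
Proof. by case=> v _ []. Qed.

Lemma side_edges_all_bags v w h : adj v w -> S v -> ~ S w ->
  side_edges V h0 h1 [set v; w] -> V h v -> V h w -> side v h.
Proof.
move=> vw Sv nSw /(side_edgesP vw Sv nSw)[k kw vk] hv hw.
apply: (component_trans vk); apply: (outside_same_component vw) => //.
exact: component_vset vk.
Qed.

(** The bag containing the triangle has the same side as any other bag containing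
    the edge vw. *)
Lemma side_edges_triangle v w w' : adj v w -> adj v w' -> adj w w' ->
  S v -> ~ S w -> ~ S w' ->
  side_edges V h0 h1 [set v; w] -> side_edges V h0 h1 [set v; w'].
Proof.
move=> vw vw' ww' Sv nSw nSw' E0vw.
have [||k kX] := coverV (clique_setU1 (clique2 vw) _ : clique ([set v; w] `|` [set w'])).
- by move=> s [->|->].
- by exists v; left; left.
have kv : V k v by apply: kX; left; left.
have kw : V k w by apply: kX; left; right.
apply/side_edgesP => //; exists k; first by apply: kX; right.
exact: side_edges_all_bags E0vw kv kw.
Qed.

(** The bag k containing the triangle is connected to h0 or h1 within the nodes
    containing v and v' and without the edge h0h1; the side of k with respect to v
    decides which one, and this side is then also the side with respect to v'. *)
Lemma side_edges_triangle_shared_edge v v' w : adj v v' -> adj v w -> adj v' w ->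
  S v -> S v' -> ~ S w ->
  side_edges V h0 h1 [set v; w] -> side_edges V h0 h1 [set v'; w].
Proof.
move=> vv' vw v'w Sv Sv' nSw E0vw.
have [||k kX] := coverV (clique_setU1 (clique2 vv') _ : clique ([set v; v'] `|` [set w])).
- by move=> s [->|->].
- by exists v; left; left.
have kv : V k v by apply: kX; left; left.
have kv' : V k v' by apply: kX; left; right.
have kw : V k w by apply: kX; right.
have sk := side_edges_all_bags vw Sv nSw E0vw kv kw.
apply/side_edgesP => //; exists k => //.
set A := inter_subgraph (copart V v) (copart V v').
have A01 : edge A h0 h1 by apply/andP; split; apply: copart_edge.
have [_ /(_ h0 k)] := edgeV vv' => /(_ _ _)/(component_del_edge A01)[].
- by case: Sv Sv' => ? ? [].
- by [].
- apply: component_sub; first by move=> ? [].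
  by move=> a b /del_edgeP[/andP[_ ab] n1 n2]; apply/del_edgeP.
move=> cs; case: (side_disjoint Sv sk); apply: component_sub cs; first by move=> ? [].
by move=> a b /del_edgeP[/andP[ab _] n1 n2]; apply/del_edgeP.
Qed.

End OneEdge.

Lemma adhesionC h0 h1 : adhesion V h0 h1 = adhesion V h1 h0.
Proof. exact: setIC. Qed.

(** Removing the edge h0h1 from the tree H_v leaves two components, and by
    [outside_same_component] all bags containing a boundary edge at v lie in the
    same one. *)
Lemma induced_pre_separation h0 h1 : adj h0 h1 ->
  pre_separation (side_edges V h0 h1) (adhesion V h0 h1) (side_edges V h1 h0).
Proof.
move=> h01; have h10 : adj h1 h0 by rewrite adj_sym.
split; apply/seteqP; split=> e //.
- move=> [E0e E1e]; have [v [w [vw Sv nSw eqe]]] := side_boundary E0e.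
  rewrite eqe in E0e E1e; have /(side_edgesP vw Sv nSw)[h hw vh] := E0e.
  rewrite adhesionC in Sv nSw; have vh' := component_vset vh.
  have := side_edges_all_bags vw Sv nSw E1e vh' hw.
  by apply: side_disjoint vh => //; rewrite adhesionC.
- by case=> /side_boundary; rewrite // adhesionC.
move=> [v [w [vw Sv nSw ->]]]; have [_ edgeG] := edgeV vw.
have [[h [hv hw]] _] := edgeV vw.
have [vh|vh] := side_cover h01 Sv hv; [left|right].
  by apply/side_edgesP => //; exists h.
by apply/side_edgesP; rewrite 1?adhesionC //; exists h.
Qed.

Section Local.
Variables (r : nat) (h0 h1 : H).
Hypothesis h01 : adj h0 h1.
Hypothesis short : forall (X : set G) (c : seq G), size c <= r ->
  (forall x, X x -> x \in c) -> chordal (induced X).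

Local Notation S := (adhesion V h0 h1).
Local Notation E0 := (side_edges V h0 h1).

Lemma adhesion_clique : clique S.
Proof. by apply: clique_subset (@cliqueV h0) => ? []. Qed.

Lemma side_edges_component v (X : set G) a b : S v -> (forall x, X x -> ~ S x) ->
  component (induced (X `&` [set z | adj v z])) a b ->
  E0 [set v; a] -> E0 [set v; b].
Proof.
move=> Sv XS ab E0a; move: b ab; apply: component_ind => //.
move=> y z _ IH /induced_edgeP[yz [/XS nSy vy] [/XS nSz vz]].
exact: side_edges_triangle IH.
Qed.

(** For x = y, [component_in_nbhd] connects a to b by a path of neighbours of x, and
    consecutive triangles at x have the same side.  For x and y distinct, the same
    lemma applied to a path from a to y gives a common neighbour q of x and y
    outside the adhesion set, at which one passes from x to y. *)
Lemma side_edges_around_cycle c x y a b : size c <= r -> x \in c -> y \in c ->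
  S x -> S y -> adj x a -> adj y b ->
  component (induced ([set` c] `\` S)) a b -> E0 [set x; a] -> E0 [set y; b].
Proof.
set X := [set` c] `\` S => cr xc yc Sx Sy xa yb ab.
have nXS z : S z -> ~ X z by move=> Sz [].
have XS z : X z -> ~ S z by case.
have XUc z : z \in c -> chordal (induced (X `|` [set z])).
  by move=> zc; apply: short cr _ => t [[]|->].
have around z a' b' : z \in c -> S z -> adj z a' -> adj z b' ->
    component (induced X) a' b' -> E0 [set z; a'] -> E0 [set z; b'].
  move=> zc Sz za zb a'b'; apply: (side_edges_component (X := X)) => //.
  exact: component_in_nbhd (nXS z Sz) (XUc z zc) za zb a'b'.
have [eqxy|xy] := eqVneq x y; first by rewrite -eqxy in yb *; exact: around.
have {}xy : adj x y by apply: adhesion_clique.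
have xney : x <> y by move=> eqxy; move: xy; rewrite eqxy adj_irr.
have : component (induced ((X `|` [set y]) `&` [set z | adj x z])) a y.
  apply: component_in_nbhd => //.
  - by case=> [/(nXS _ Sx)|].
  - by apply: short cr _ => t [[[]|->]|->].
  apply: (@component_trans _ _ b); first by apply: component_induced_sub ab => t; left.
  apply: component_edge; apply/induced_edgeP; split; [by rewrite adj_sym| | by right].
  by left; exact: component_vset ab.
set Y := (X `|` [set y]) `&` _ => ay.
have [q [aq qy]] : exists q,
    component (induced (X `&` [set z | adj x z])) a q /\ adj q y.
  have Xa : X a by have [] := ab.
  pose Q z := (exists q, component (induced (X `&` [set z | adj x z])) a q /\ adj q y)
    \/ component (induced (X `&` [set z | adj x z])) a z.
  (* Q z says that the path has reached z inside X, unless it passed through y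
     before. *)
  suff [//|/component_vset[/XS//]] : Q y.
  apply: (component_ind _ _ ay); first by right; apply: component_refl; split.
  move=> z t _ [Qz|az]; first by left.
  move=> /induced_edgeP[zt _ [Yt xt]]; case: Yt => [Xt|ty]; last by left; exists z; rewrite -ty.
  right; apply: (component_trans az); apply/component_edge/induced_edgeP.
  by split=> //; exact: component_vset az.
move=> E0xa; have [Xq xq] := component_vset aq.
have E0xq : E0 [set x; q] by apply: side_edges_component aq E0xa.
have yq : adj y q by rewrite adj_sym.
have E0yq : E0 [set y; q].
  by apply: side_edges_triangle_shared_edge E0xq => //; exact: XS.
apply: (around _ q) => //; apply: component_trans _ ab.
apply: component_sym; apply: component_induced_sub aq => t.
by case.
Qed.

Lemma induced_local_separation : local_separation r E0 S (side_edges V h1 h0).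
Proof.
have pre := induced_pre_separation h01; split=> // x p [[xp Sx Sp nS] lp].
have [E01 E0U] := pre.
have disj e : E0 e -> side_edges V h1 h0 e -> False.
  by move=> E0e E1e; have : (E0 `&` side_edges V h1 h0) e by []; rewrite E01.
have bd0 e : E0 e -> boundary S e by move=> E0e; rewrite -E0U; left.
have bd1 e : side_edges V h1 h0 e -> boundary S e by move=> E1e; rewrite -E0U; right.
have bdS u w : boundary S [set u; w] -> S u -> S w -> False.
  by move=> [a [b [_ Sa nSb eq_e]]]; have [[-> ->]|[-> ->]] := set2_eq eq_e.
case=> -[e0 [pe0 E0e0]] [e1 [pe1 E1e1]].
case: lp => [[c [cc cr pc pec]]|[y [py Sy]]]; last first.
  move: pe0; rewrite py => /walk_edges_cons[eqe0|[]//].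
  by rewrite eqe0 in E0e0; exact: bdS (bd0 _ E0e0) Sx Sy.
case/lastP: p xp Sp nS pc pec pe0 pe1 => [|p y]; first by move=> _ _ _ _ _ [].
rewrite last_rcons belast_rcons => xp Sy nS pc _ pe0 pe1.
case: p xp nS pc pe0 pe1 => [|a q] xp nS pc pe0 pe1.
  case/walk_edges_cons: pe0 => [eqe0|[]//].
  by rewrite eqe0 in E0e0; exact: bdS (bd0 _ E0e0) Sx Sy.
set b := last a q.
have nSaq z : z \in a :: q -> ~ S z by exact: nS.
have ends e : walk_edges x (rcons (a :: q) y) e -> boundary S e ->
    e = [set x; a] \/ e = [set y; b].
  rewrite rcons_cons => /walk_edges_cons[|]; first by left.
  rewrite -cats1 => /walk_edges_cat[|/walk_edges_cons[->|[]//]]; last by rewrite setUC; right.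
  move: xp; rewrite [path _ _ _]/= rcons_path => /and3P[_ aq _].
  (* Inner edges of the walk have both ends outside S, hence are not boundary edges. *)
  have interior : walk_edges a q `<=` [set e | ~ boundary S e].
    apply: (walk_edges_path aq) => u w /nSaq nSu /nSaq nSw _ [u' [w' [_ Su' _ eq_e]]].
    have [[eu ew]|[eu ew]] := set2_eq eq_e; first by apply: nSu; rewrite eu.
    by apply: nSw; rewrite ew.
  by move=> /interior.
have pcin z : z \in x :: rcons (a :: q) y -> z \in c by apply: pc.
have xc : x \in c by apply: pcin; rewrite mem_head.
have yc : y \in c by apply: pcin; rewrite inE mem_rcons mem_head orbT.
move: xp; rewrite [path _ _ _]/= rcons_path => /and3P[xa aq b_y].
have yb : adj y b by rewrite adj_sym.
have ab : component (induced ([set` c] `\` S)) a b.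
  have aqX z : z \in a :: q -> ([set` c] `\` S) z.
    move=> zq; split; last exact: nSaq.
    by apply: pcin; rewrite inE mem_rcons inE zq !orbT.
  by split; [apply: aqX; rewrite mem_head | exists q => //; exact: path_induced].
have around := @side_edges_around_cycle c.
case: (ends _ pe0 (bd0 _ E0e0)) (ends _ pe1 (bd1 _ E1e1)) => e0E [] e1E;
  rewrite e0E in E0e0; rewrite e1E in E1e1; try exact: disj E0e0 E1e1.
  by apply: (disj [set y; b]) => //; apply: (around x y a b).
apply: (disj [set x; a]) => //; apply: (around y x b a) => //.
exact: component_sym.
Qed.

End Local.
End InducedSeparations.

(** * A canonical clique in a connected chordal graph *)

Section Centre.
Variable G : graph.
Implicit Types (C X : set G) (a b x y z : G) (l : seq G).

Definition simplicial C z : Prop := C z /\ clique (C `&` [set t | adj z t]).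

(** Cliques, all of whose vertices are simplicial, are left unchanged, so that the
    iteration does not end with the empty set. *)
Definition prune C : set G := [set z | C z /\ (clique C \/ ~ simplicial C z)].

(** The iteration of prune becomes stationary on finite sets; the intersection of
    all iterates names the result without a bound on the number of steps. *)
Definition centre C : set G := [set z | forall n, iter n prune C z].

Definition connected_set C : Prop :=
  forall x y, C x -> C y -> component (induced C) x y.

Lemma not_clique C : ~ clique C -> exists x y, [/\ C x, C y, x != y & ~~ adj x y].
Proof.
move=> ncC; apply: contrapT => nxy; apply: ncC => x y Cx Cy xy.
by apply: contrapT => nadj; apply: nxy; exists x, y; split=> //; apply/negP.
Qed.

(** Let D be the component of b among the vertices that are neither a nor adjacent
    to a, and let N be the set of neighbours of a with a neighbour in D.  As two
    vertices of N are joined through D, chordality makes N a clique.  The neighbours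
    of a vertex of D lie in D and N together, so it suffices to find a vertex in D
    that is simplicial in this smaller set.  If the set is not a clique, induction is
    applied to a vertex s that equals or is adjacent to every vertex of N; the
    simplicial vertex obtained is not adjacent to s, so it lies in D. *)
Lemma simplicial_nonadjacent C l a b : (forall z, C z -> z \in l) -> chordal (induced C) ->
  C a -> C b -> a != b -> ~~ adj a b ->
  exists z, [/\ simplicial C z, z != a & ~~ adj a z].
Proof.
have [n] := ubnP (count (fun u => u \in C) l).
elim: n C a b => // n IH C a b; rewrite ltnS => Cn Cl chC Ca Cb ab nab.
pose far : set G := [set z | [/\ C z, z != a & ~~ adj a z]].
have far_b : far b by split=> //; rewrite eq_sym.
pose D := component (induced far) b.
have Dfar z : D z -> far z by exact: component_vset.
have Db : D b by exact: component_refl.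
have Dgrow z t : D z -> C t -> adj z t -> t != a -> ~~ adj a t -> D t.
  move=> Dz Ct zt ta nat; apply: (component_trans Dz).
  by apply/component_edge/induced_edgeP; split=> //; exact: Dfar.
pose N : set G := [set s | [/\ C s, adj a s & exists2 d, D d & adj s d]].
have cliqueN : clique N.
  move=> s s' [Cs as_ [d Dd sd]] [Cs' as' [d' Dd' s'd']] ss'.
  pose X := D `|` [set s; s'].
  have XC : X `|` [set a] `<=` C by move=> z [[/Dfar[]//|[->|->]]//|->].
  have Xa : ~ X a.
    move=> [/Dfar[_ /eqP//]|[] eqa]; first by rewrite -eqa adj_irr in as_.
    by rewrite -eqa adj_irr in as'.
  have XD z : D z -> X z by left.
  have Xs : X s by right; left.
  have Xs' : X s' by right; right.
  have conX : component (induced X) s s'.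
    have sd' : component (induced X) s d.
      by apply/component_edge/induced_edgeP; split=> //; exact: XD.
    have ds' : component (induced X) d' s'.
      by apply/component_edge/induced_edgeP; split=> //; [rewrite adj_sym | exact: XD].
    apply: (component_trans sd'); apply: component_trans _ ds'.
    apply: (component_induced_sub XD); apply: (@component_trans _ _ b).
      by apply: component_sym; exact: component_connected.
    exact: component_connected.
  have := component_in_nbhd Xa (chordal_mono XC chC) as_ as' conX.
  have nbX z : (X `&` [set t | adj a t]) z -> z = s \/ z = s'.
    by move=> [[/Dfar[_ _ /negP nz]|[->|->]] az]; [case: nz | left | right].
  move=> ss'c; have [//|nss'] := boolP (adj s s').
  have : s' = s; last by move=> eqs; rewrite eqs eqxx in ss'.
  apply: (component_ind (Q := fun t => t = s) _ _ ss'c) => // y z _ -> /induced_edgeP.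
  case=> [sz _ /nbX[//|zs']].
  by rewrite -zs' sz in nss'.
pose C1 := D `|` N.
have C1C : C1 `<=` C by move=> z [/Dfar[]|[]].
have nC1a : ~ C1 a.
  by move=> [/Dfar[_ /eqP//]|[_]]; rewrite adj_irr.
have C1n : count (fun u => u \in C1) l < n.
  by apply: leq_trans Cn; exact: count_mem_lt C1C Ca nC1a (Cl a Ca).
have C1l z : C1 z -> z \in l by move=> /C1C/Cl.
have chC1 := chordal_mono C1C chC.
(* A vertex of D has all its neighbours in C1. *)
have lift z : D z -> simplicial C1 z -> exists z, [/\ simplicial C z, z != a & ~~ adj a z].
  move=> Dz [_ cz]; have [Cz za naz] := Dfar z Dz; exists z; split=> //; split=> //.
  apply: clique_subset cz => t [Ct zt]; split=> //; have {}zt : adj z t := zt.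
  have ta : t != a by apply: contraNneq naz => <-; rewrite adj_sym.
  have [at_|nat] := boolP (adj a t); last by left; exact: Dgrow Dz Ct zt ta nat.
  by right; split=> //; exists z => //; rewrite adj_sym.
have from_dominating s t : C1 s -> C1 t -> s != t -> ~~ adj s t ->
    (forall z, N z -> z = s \/ adj s z) ->
    exists z, [/\ simplicial C z, z != a & ~~ adj a z].
  move=> C1s C1t st nst Ns; have [z [sz zs nsz]] := IH C1 s t C1n C1l chC1 C1s C1t st nst.
  have [[Dz|Nz] _] := sz; first exact: (lift z).
  by case: (Ns z Nz) => [eqz|az]; [rewrite eqz eqxx in zs | rewrite az in nsz].
have [cC1|/not_clique[x [y [C1x C1y xy nxy]]]] := pselect (clique C1).
  by apply: (lift b) => //; split; [left | apply: clique_subset cC1 => t []].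
have [[s [t [Ns C1t st nst]]]|univ] := pselect
    (exists s t, [/\ N s, C1 t, s != t & ~~ adj s t]).
  apply: (from_dominating s t) => //; first by right.
  move=> z Nz; have [->|zs] := eqVneq z s; first by left.
  by right; apply: cliqueN; rewrite // eq_sym.
apply: (from_dominating x y) => // z Nz; have [->|zx] := eqVneq z x; first by left.
right; rewrite adj_sym; apply: contrapT => /negP nzx; apply: univ.
by exists z, x.
Qed.

Lemma prune_sub C : prune C `<=` C.
Proof. by move=> z []. Qed.

Lemma prune_clique C : clique C -> prune C = C.
Proof. by move=> cC; apply/seteqP; split=> z; [case | split; [|left]]. Qed.

Lemma centre_sub C : centre C `<=` C.
Proof. by move=> z /(_ 0). Qed.

Lemma centre_prune C : centre (prune C) = centre C.
Proof.
apply/seteqP; split=> z cz n; last by rewrite -iterSr; exact: cz.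
case: n => [|n]; last by rewrite iterSr; exact: cz.
by apply: prune_sub; exact: (cz 0).
Qed.

(** The two neighbours of a simplicial vertex on a path are equal or adjacent, so
    the vertex can be bypassed. *)
Lemma prune_connected C : connected_set C -> connected_set (prune C).
Proof.
move=> conC x y px py; have [cC|ncC] := pselect (clique C).
  by rewrite prune_clique //; apply: conC; exact: prune_sub.
have [_ [p xp pl]] := conC x y (prune_sub px) (prune_sub py).
have [n] := ubnP (size p); elim: n p x xp pl px => // n IH p x xp pl px; rewrite ltnS => pn.
case: p xp pl pn => [|a p]; first by move=> _ <- _; exact: component_refl.
rewrite [path _ _ _]/= => /andP[/induced_edgeP[xa Cx Ca] ap] pl pn.
have [pa|npa] := pselect (prune C a).
  apply: (@component_trans _ _ a); last exact: (IH p).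
  by apply/component_edge/induced_edgeP.
have [_ cla] : simplicial C a.
  by apply: contrapT => nsa; apply: npa; split=> //; right.
case: p ap pl pn => [|b p] ap pl pn; first by move: pl npa py => /= ->.
move: ap => /= /andP[/induced_edgeP[ab _ Cb] bp].
have [xb|xb] := eqVneq x b.
  by apply: (IH p) => //; [rewrite xb | rewrite xb | exact: ltnW pn].
apply: (IH (b :: p)) => //=; apply/andP; split=> //; apply/induced_edgeP.
by split=> //; apply: cla => //; split=> //; rewrite /= adj_sym.
Qed.

(** A path all of whose inner vertices are simplicial can be shortened to an edge;
    so pruning never deletes all vertices. *)
Lemma simplicial_clique C : connected_set C -> (forall z, C z -> simplicial C z) ->
  clique C.
Proof.
move=> conC simC x y Cx Cy; apply/implyP; rewrite implyNb; apply/orP.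
apply: (component_ind (Q := fun y => x == y \/ adj x y) _ _ (conC x y Cx Cy)).
  by left.
move=> a b xa [/eqP<-|xa'] /induced_edgeP[ab Ca Cb]; first by right.
have [->|xb] := eqVneq x b; first by left.
right; have [_ cla] := simC a Ca; apply: cla => //; split=> //.
by rewrite /= adj_sym.
Qed.

Lemma centreP C l : (forall z, C z -> z \in l) -> chordal (induced C) ->
  connected_set C -> C !=set0 -> clique (centre C) /\ centre C !=set0.
Proof.
have [n] := ubnP (count (fun u => u \in C) l).
elim: n C => // n IH C; rewrite ltnS => Cn Cl chC conC [x Cx].
have [cC|ncC] := pselect (clique C).
  have -> : centre C = C.
    have stable k : iter k prune C = C by elim: k => //= k ->; exact: prune_clique.
    by apply/seteqP; split=> z; [exact: centre_sub | move=> Cz k; rewrite stable].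
  by split=> //; exists x.
have [a [b [Ca Cb ab nab]]] := not_clique ncC.
have [z [sz _ _]] := simplicial_nonadjacent Cl chC Ca Cb ab nab.
rewrite -centre_prune; apply: IH.
- apply: leq_trans Cn; apply: (count_mem_lt (@prune_sub C) (_ : C z)).
  + by case: sz.
  + by case=> _ [].
  + by apply: Cl; case: sz.
- by move=> t /prune_sub/Cl.
- exact: chordal_mono (@prune_sub C) chC.
- exact: prune_connected.
apply: contrapT => empty; apply: ncC; apply: simplicial_clique => // t Ct.
by apply: contrapT => nst; apply: empty; exists t; split=> //; right.
Qed.

End Centre.

(** * Automorphisms and the four conditions *)

Section Automorphisms.
Variable G : graph.
Implicit Types (f g : automorphism G) (X S C K : set G) (x y z : G).

Lemma aut_inverse f : exists g, cancel f g /\ cancel g f.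
Proof.
have [g fK gK] := aut_bij f.
have gadj x y : adj (g x) (g y) = adj x y by rewrite -(aut_adj f) !gK.
by exists (@Automorphism G g (Bijective gK fK) gadj).
Qed.

Lemma aut_inj f : injective f.
Proof. exact: bij_inj (aut_bij f). Qed.

Lemma image_cancel f g X : cancel f g -> g @` (f @` X) = X.
Proof.
move=> fK; rewrite image_comp; apply/seteqP.
by split=> [x [y Xy <-]|x Xx]; [rewrite /= fK | exists x; rewrite //= fK].
Qed.

(** The reverse inclusion is the hypothesis for the inverse automorphism. *)
Lemma equivariant_of_sub (F : set G -> set G) :
  (forall f X, f @` F X `<=` F (f @` X)) -> forall f X, F (f @` X) = f @` F X.
Proof.
move=> subF f X; apply/seteqP; split; last exact: subF.
have [g [fK gK]] := aut_inverse f => z Fz; exists (g z); last exact: gK.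
by rewrite -(image_cancel X fK); apply: subF; exists z.
Qed.

Lemma aut_clique f K : clique K -> clique (f @` K).
Proof.
move=> cK _ _ [x Kx <-] [y Ky <-] fxy; rewrite aut_adj; apply: cK => //.
by apply: contraNneq fxy => ->.
Qed.

Lemma aut_link f S : link (f @` S) = f @` link S.
Proof.
move: f S; apply: equivariant_of_sub => f S _ [x [nSx Sx] <-]; split.
  by move=> [y Sy /aut_inj yx]; rewrite -yx in nSx.
by move=> _ [s Ss <-]; rewrite aut_adj; exact: Sx.
Qed.

Lemma aut_component f X x :
  component (induced (f @` X)) (f x) = f @` component (induced X) x.
Proof.
have sub g Y y : g @` component (induced Y) y `<=`
    component (induced (g @` Y)) (g y).
  move=> _ [z yz <-]; have Yy : Y y by have [] := yz.
  apply: (component_ind (Q := fun z => component (induced (g @` Y)) (g y) (g z)) _ _ yz).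
    by apply: component_refl; exists y.
  move=> a b _ ya /induced_edgeP[ab Ya Yb]; apply: (component_trans ya).
  by apply/component_edge/induced_edgeP; split; [rewrite aut_adj | exists a | exists b].
apply/seteqP; split; last exact: sub.
have [g [fK gK]] := aut_inverse f => z xz; exists (g z); last exact: gK.
rewrite -(image_cancel X fK) -(fK x); by apply: sub; exists z.
Qed.

Lemma aut_simplicial f C : simplicial (f @` C) = f @` simplicial C.
Proof.
move: f C; apply: equivariant_of_sub => f C _ [z [Cz cz] <-]; split; first by exists z.
move=> _ _ [[x Cx <-] zx] [[y Cy <-] zy] xy; rewrite /= !aut_adj in zx zy *.
by apply: cz => //; apply: contraNneq xy => ->.
Qed.

Lemma aut_prune f C : prune (f @` C) = f @` prune C.
Proof.
move: f C; apply: equivariant_of_sub => f C _ [z [Cz pz] <-]; split; first by exists z.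
case: pz => [cC|nsz]; [left; exact: aut_clique | right].
by rewrite aut_simplicial => -[y sy /aut_inj yz]; rewrite yz in sy.
Qed.

Lemma aut_centre f C : centre (f @` C) = f @` centre C.
Proof.
move: f C; apply: equivariant_of_sub => f C _ [z cz <-] n.
have -> : iter n (@prune G) (f @` C) = f @` iter n (@prune G) C.
  by elim: n => //= n ->; rewrite aut_prune.
by exists z.
Qed.

End Automorphisms.

Section CanonicalGraph.
Variable G : graph.

Definition centre_graph : graph :=
  clique_graph (@clique G) id (fun S C => S `|` centre C).

Definition centre_bag : centre_graph -> set G := @clique_bag G _ _ _.

Lemma centre_bag_clique h : clique (centre_bag h).
Proof. by apply/asboolP; exact: (valP h). Qed.

Definition act_node (f : automorphism G) (h : centre_graph) : centre_graph :=
  mk_node _ _ (aut_clique (f := f) (@centre_bag_clique h)).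

Lemma act_node_adj f h k : adj h k -> adj (act_node f h) (act_node f k).
Proof.
have star S K K' : star_edge id (fun S C => S `|` centre C) S K K' ->
    star_edge id (fun S C => S `|` centre C) (f @` S) (f @` K) (f @` K').
  move=> [x [cS [s Ss] lx nroot [-> ->]]]; exists (f x); split.
  - exact: aut_clique.
  - by exists (f s), s.
  - by rewrite aut_link; exists x.
  - by move=> [y [fSy /component_vset[]]].
  - by rewrite aut_link aut_component aut_centre image_setU.
case/andP=> hk /asboolP[S star_hk]; apply/andP; split; last first.
  by apply/asboolP; exists (f @` S); case: star_hk => /star; [left|right].
apply: contra_neq hk => /(congr1 val)/= eq_hk; apply: val_inj.
have [g [fK gK]] := aut_inverse f.
by rewrite -(image_cancel (val h) fK) eq_hk image_cancel.
Qed.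

Lemma act_nodeK (f g : automorphism G) : cancel f g -> cancel (act_node f) (act_node g).
Proof. by move=> fK h; apply: val_inj; exact: image_cancel. Qed.

Lemma act_node_bij f : bijective (act_node f).
Proof.
have [g [fK gK]] := aut_inverse f.
by exists (act_node g); apply: act_nodeK.
Qed.

Lemma act_node_adjE f h k : adj (act_node f h) (act_node f k) = adj h k.
Proof.
apply/idP/idP; last exact: act_node_adj.
have [g [fK gK]] := aut_inverse f.
by move=> /(act_node_adj g); rewrite !act_nodeK.
Qed.

Lemma centre_graph_canonical : canonical_decomposition centre_bag.
Proof.
exists (fun f => Automorphism (act_node_bij f) (act_node_adjE f)); split=> //=.
- by move=> h; apply: val_inj; rewrite /= image_id.
- by move=> f g h; apply: val_inj; rewrite /= image_comp.
Qed.

End CanonicalGraph.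

Section ChordalToDecomposition.
Variables (G : graph) (r : nat).
Hypothesis finG : locally_finite G.
Hypothesis r3 : 3 <= r.
Hypothesis lcG : locally_chordal G r.

Let chG v : chordal (induced (closed_nbhd v)) := locally_chordal_nbhd r3 lcG.

(** Common part of the two constructions: whatever the family of cliques and the
    choices of root and rep, the resulting decomposition induces local
    separations. *)
Lemma clique_graph_local_decomposition P root rep :
  (forall K, P K -> clique K) ->
  (forall S, clique S -> S !=set0 -> P (root S) /\ S `<=` root S) ->
  (forall S, P S -> S !=set0 -> root S = S) ->
  (forall S x, clique S -> S !=set0 -> link S x ->
    let C := component (induced (link S)) x in
    [/\ P (rep S C), S `<=` rep S C & rep S C `&` C !=set0]) ->
  let V := @clique_bag G P root rep in
  [/\ graph_decomposition V, into_cliques V & induces_local_separations r V].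
Proof.
move=> cliqueP rootP root_id repP V.
have treeV v : is_tree (copart V v) by exact: clique_graph_trees.
have edgeV u v : adj u v -> connected_subgraph (inter_subgraph (copart V u) (copart V v)).
  exact: clique_graph_edge_connected.
have cliqueV : into_cliques V by move=> h; exact: bag_clique.
split=> //; first exact: clique_graph_decomposition.
split=> // h0 h1 h01; apply: induced_local_separation => //.
  exact: clique_graph_covers.
by move=> X c; exact: locally_chordal_short_cycles.
Qed.

Lemma maximal_clique_decomposition : exists (H : graph) (V : H -> set G),
  [/\ graph_decomposition V, into_maximal_cliques V
    & induces_local_separations r V].
Proof.
pose P := @maximal_clique G.
pose root S := xget set0 [set K | P K /\ S `<=` K].
pose rep S C := xget set0 [set K | [/\ P K, S `<=` K & K `&` C !=set0]].
have rootP S : clique S -> S !=set0 -> P (root S) /\ S `<=` root S.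
  move=> cS [v Sv].
  by have := xgetPex set0 (maximal_clique_exists finG cS Sv).
have [|||decV _ locV] := @clique_graph_local_decomposition P root rep _ rootP.
- by move=> K [].
- move=> S PS S0; have [cS maxS] := PS; have [[cr _] Sr] := rootP S cS S0.
  exact: maxS.
- move=> S x cS [v Sv] lx C.
  apply: (@xgetPex _ set0 [set K | [/\ P K, S `<=` K & K `&` C !=set0]]).
  have [K [mK SK]] := maximal_clique_exists finG (clique_link cS lx) (or_introl Sv).
  exists K; split=> //; first by move=> s Ss; apply: SK; left.
  by exists x; split; [apply: SK; right | exact: component_refl].
exists (clique_graph P root rep), (@clique_bag G P root rep); split=> //.
split.
- by move=> h _; exact: bagP.
- by move=> h k _ _; exact: val_inj.
- by move=> K PK; exists (mk_node root rep PK).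
Qed.

Lemma canonical_clique_decomposition : exists (H : graph) (V : H -> set G),
  [/\ graph_decomposition V, into_cliques V, canonical_decomposition V
    & induces_local_separations r V].
Proof.
have [||||decV cliqueV locV] := @clique_graph_local_decomposition (@clique G) id (fun S C => S `|` centre C).
- by [].
- by move=> S cS _; split.
- by [].
- move=> S x cS [v Sv] lx C.
  have CN : C `<=` closed_nbhd v.
    by move=> z /component_vset/(link_sub_nbhd Sv)[].
  have [l ln] := finite_nbhd finG v.
  have [|||cC [z cz]] := @centreP G C l _ (chordal_mono CN (@chG v)).
  + by move=> z /CN/ln.
  + move=> y z xy xz; apply: (@component_trans _ _ x).
      by apply: component_sym; exact: component_connected.
    exact: component_connected.
  + by exists x; exact: component_refl.
  have Cz : C z by exact: centre_sub.
  split; last by exists z; split; [right|].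
    move=> a b [Sa|ca] [Sb|cb] ab; first exact: cS.
    - by have [_] := component_vset (centre_sub cb); apply.
    - rewrite adj_sym; by have [_] := component_vset (centre_sub ca); apply.
    - exact: cC.
  by move=> s Ss; left.
exists (centre_graph G), (@centre_bag G); split=> //.
exact: centre_graph_canonical.
Qed.

End ChordalToDecomposition.

Theorem theorem7 (G : graph) (r : nat) (hG : locally_finite G)
    (hr : (3 <= r)%N) :
  [<-> locally_chordal G r;
       exists (H : graph) (V : H -> set G),
         [/\ graph_decomposition V, into_maximal_cliques V
           & induces_local_separations r V];
       exists (H : graph) (V : H -> set G),
         [/\ graph_decomposition V, into_cliques V, canonical_decomposition V
           & induces_local_separations r V];
       exists (H : graph) (V : H -> set G),
         [/\ graph_decomposition V, into_cliques V
           & induces_local_separations r V]].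
Proof.
tfae.
- exact: maximal_clique_decomposition.
- move=> [H [V [decV [maxV _ _] locV]]].
  apply: canonical_clique_decomposition => //.
  by apply: (decomposition_locally_chordal decV _ locV) => h; have [] := maxV h I.
- by move=> [H [V [decV cliqueV _ locV]]]; exists H, V; split.
- by move=> [H [V [decV cliqueV locV]]]; exact: decomposition_locally_chordal locV.
Qed.
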